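(* Let $S_0,\sigma:\mathbb{R}\to\mathbb{R}$ be such that $(S_0,\sigma)$ satisfies A1, A2 and A3. Let $\mathcal S$ be the class of functions $S:\mathbb{R}\to\mathbb{R}$ such that $(S,\sigma)$ satisfies A1, A2, A3 and $$\int_0^{u_S}\left(S(x_t^S)-S_0(x_t^S)\right)dt\neq0\quad\text{for some }u_S\in[0,T].$$ Let $S\in\mathcal S$ (alternative $H_1$), and for each $\varepsilon>0$ let $X=X^\varepsilon$ be the solution of $$X_t=x_0+\int_0^t S(X_s)\,ds+\varepsilon\int_0^t\sigma(X_s)\,dW_s,\quad t\in[0,T],$$ observed according to the Sampling Scheme. Let $$U^\varepsilon(u)=\varepsilon^{-1}\sum_{i=1}^{n(\varepsilon)}1_{[0,u]}(t_i^\varepsilon)\left[X_{t_i^\varepsilon}-X_{t_{i-1}^\varepsilon}-S_0(X_{t_{i-1}^\varepsilon})|t_i^\varepsilon-t_{i-1}^\varepsilon|\right],\quad u\in[0,T].$$ Suppose that $\widehat\Sigma^\varepsilon$ is a consistent estimator for $\Sigma_{S,\sigma}$, i.e. random variables with $\widehat\Sigma^\varepsilon\to\Sigma_{S,\sigma}$ in probability as $\varepsilon\downarrow0$. Then $$\frac{\sup_{u\in[0,T]}|U^\varepsilon(u)|}{\widehat\Sigma^\varepsilon}\neq O_P(1)\quad\text{as }\varepsilon\downarrow0,$$ i.e. this family of random variables is not bounded in probability as $\varepsilon\downarrow0$.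
   Context: Setting: $T>0$ and $x_0\in\mathbb{R}$ are fixed; $W$ is a standard Wiener process on a stochastic basis $(\Omega,\mathcal F,(\mathcal F_t)_{t\in[0,T]},P)$. For functions $S,\sigma:\mathbb{R}\to\mathbb{R}$ and $\varepsilon>0$, $X=X^\varepsilon$ is the unique strong solution of $X_t=x_0+\int_0^tS(X_s)ds+\varepsilon\int_0^t\sigma(X_s)dW_s$, $t\in[0,T]$ (the dependence on $\varepsilon$ is suppressed). $x^S$ denotes the solution of $dx^S_t/dt=S(x^S_t)$, $x^S_0=x_0$, on $[0,T]$. Conditions on $(S,\sigma)$ (and likewise on $(S_0,\sigma)$, with $S$ replaced by $S_0$ everywhere, including in the equations for $X$ and $x^S$): A1: there is $C>0$ with $|S(x)-S(y)|\le C|x-y|$ and $|\sigma(x)-\sigma(y)|\le C|x-y|$ for all $x,y\in\mathbb{R}$. A2: $\sup_{s\in[0,T]}E|X_s|^2<\infty$ (for each $\varepsilon$). A3: $\Sigma_{S,\sigma}:=\sqrt{\int_0^T\sigma(x^S_t)^2dt}>0$. Sampling Scheme: for each $\varepsilon$, $X$ is observed at deterministic times $0=t_0^\varepsilon<t_1^\varepsilon<\cdots<t_{n(\varepsilon)}^\varepsilon=T$ such that $h_\varepsilon:=\max_{1\le i\le n(\varepsilon)}|t_i^\varepsilon-t_{i-1}^\varepsilon|=o(\varepsilon^2)$ as $\varepsilon\downarrow0$. *)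

(* Defs.v *)
From mathcomp Require Import all_boot all_order all_algebra.
From mathcomp Require Import all_classical all_reals all_analysis.
Import Order.TTheory GRing.Theory Num.Theory.
Import numFieldNormedType.Exports.

Set Implicit Arguments.
Unset Strict Implicit.
Unset Printing Implicit Defensive.

Local Open Scope classical_set_scope.
Local Open Scope ring_scope.

Section partitions.
Context {R : realType}.

Definition is_partition (T : R) (n : nat) (t : nat -> R) : Prop :=
  [/\ t 0%N = 0, t n = T & forall i, (i < n)%N -> t i < t i.+1].

Definition mesh (n : nat) (t : nat -> R) : R :=
  \big[Num.max/0]_(1 <= i < n.+1) `|t i - t i.-1|.

End partitions.

Section probability_notions.
Context {R : realType} {d : measure_display} {Omega : measurableType d}.
Variable P : probability Omega R.

(** A family indexed by [I], along the filter [L] on [I]. *)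
Definition cvg_in_probability (I : Type) (L : set_system I)
    (Y : I -> Omega -> R) (Z : Omega -> R) : Prop :=
  forall delta : R, 0 < delta ->
    (fun i => P [set w | delta <= `|Y i w - Z w|]) @ L --> 0%E.

(** [Y = O_P(1)] along [L]. *)
Definition bounded_in_probability (I : Type) (L : set_system I)
    (Y : I -> Omega -> R) : Prop :=
  forall eta : R, 0 < eta -> exists M : R,
    \forall i \near L, (P [set w | (M < `|Y i w|)%R] <= eta%:E)%E.

End probability_notions.

Section stochastic_calculus.
Context {R : realType} {d : measure_display} {Omega : measurableType d}.
Variables (P : probability Omega R) (T : R) (F : R -> set_system Omega).
Notation mu := (@lebesgue_measure R).

(** Neither right-continuity nor completeness is required. *)
Definition is_filtration : Prop :=
  (forall t, t \in `[0, T] ->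
     sigma_algebra [set: Omega] (F t) /\ F t `<=` measurable) /\
  (forall s t, 0 <= s -> s <= t -> t <= T -> F s `<=` F t).

Definition measurable_wrt (G : set_system Omega) (f : Omega -> R) : Prop :=
  preimage_set_system setT f measurable `<=` G.

Definition adapted (Y : R -> Omega -> R) : Prop :=
  forall t, t \in `[0, T] -> measurable_wrt (F t) (Y t).

Definition continuous_paths (Y : R -> Omega -> R) : Prop :=
  forall w, {within `[0, T], continuous (fun t => Y t w)}.

(** [normal_prob m s] has mean [m] and standard deviation [s]. *)
Definition is_wiener (W : R -> Omega -> R) : Prop :=
  [/\ adapted W,
      continuous_paths W,
      {ae P, forall w, W 0 w = 0},
      (forall s t, 0 <= s -> s < t -> t <= T ->
         forall B : set R, measurable B ->
           P [set w | B (W t w - W s w)] = normal_prob 0 (Num.sqrt (t - s)) B) &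
      (forall s t, 0 <= s -> s < t -> t <= T ->
         forall (A : set Omega) (B : set R), F s A -> measurable B ->
           P (A `&` [set w | B (W t w - W s w)]) =
             (P A * P [set w | B (W t w - W s w)%R])%E)].

(** The process [\sum_(i < m) xi i * 1_(]s i, s i.+1])]. *)
Record simple_process := SimpleProcess {
  sp_size : nat ;
  sp_grid : nat -> R ;
  sp_coef : nat -> Omega -> R }.

Definition simple_adapted (H : simple_process) : Prop :=
  [/\ is_partition T (sp_size H) (sp_grid H),
      (forall i, (i < sp_size H)%N ->
         measurable_wrt (F (sp_grid H i)) (sp_coef H i)) &
      (forall i, (i < sp_size H)%N ->
         exists K : R, forall w, `|sp_coef H i w| <= K)].

Definition simple_eval (H : simple_process) (t : R) (w : Omega) : R :=
  \sum_(i < sp_size H)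
     sp_coef H i w * \1_(`]sp_grid H i, sp_grid H i.+1]%classic) t.

Definition simple_integral (W : R -> Omega -> R) (H : simple_process)
    (t : R) (w : Omega) : R :=
  \sum_(i < sp_size H) sp_coef H i w *
     (W (Num.min (sp_grid H i.+1) t) w - W (Num.min (sp_grid H i) t) w).

(** [Z t = \int_0^t Y dW] on [0, T], for a measurable adapted [Y] with
    [\int_0^T (Y s) ^+ 2 ds < +oo] a.s.: some simple processes [H n] satisfy
    [\int_0^T (H n s - Y s) ^+ 2 ds --> 0] in probability, and their integrals
    converge in probability to [Z]. This determines [Z] up to
    indistinguishability. *)
Definition ito_integral (W Y Z : R -> Omega -> R) : Prop :=
  [/\ adapted Y /\
        measurable_fun (`[0, T] `*` [set: Omega]) (fun p => Y p.1 p.2),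
      {ae P, forall w, (\int[mu]_(s in `[0%R, T]) ((Y s w) ^+ 2)%:E < +oo)%E},
      adapted Z /\ continuous_paths Z &
      exists H : nat -> simple_process,
        [/\ (forall n, simple_adapted (H n)),
            (forall delta : R, 0 < delta ->
               (fun n => P [set w | (delta%:E <=
                  \int[mu]_(s in `[0%R, T])
                     ((simple_eval (H n) s w - Y s w) ^+ 2)%:E)%E]) @ \oo
                 --> 0%E) &
            (forall t, t \in `[0, T] ->
               cvg_in_probability P \oo
                 (fun n => simple_integral W (H n) t) (Z t))]].

(** [X t = x0 + \int_0^t S(X s) ds + eps \int_0^t sigma(X s) dW s] on [0, T],
    for the given Wiener process [W]. *)
Definition sde_solution (W : R -> Omega -> R) (x0 : R) (S sigma : R -> R)
    (eps : R) (X : R -> Omega -> R) : Prop :=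
  [/\ adapted X,
      continuous_paths X,
      {ae P, forall w, mu.-integrable `[0, T] (fun s => (S (X s w))%:E)} &
      exists2 Z : R -> Omega -> R,
        ito_integral W (fun s w => sigma (X s w)) Z &
        {ae P, forall w, forall t, t \in `[0, T] ->
           X t w = x0 + (\int[mu]_(s in `[0, t]) S (X s w)) + eps * Z t w}].

Definition ode_solution (x0 : R) (S x : R -> R) : Prop :=
  [/\ x 0 = x0,
      {within `[0, T], continuous x} &
      forall t : R, t \in `]0, T[ -> is_derive t 1 x (S (x t))].

Definition Sigma_of (sigma x : R -> R) : R :=
  Num.sqrt (\int[mu]_(t in `[0, T]) (sigma (x t)) ^+ 2).

(** Under [cond_A1] the solutions quantified over in [cond_A2], [cond_A3] and
    [alternative_class] are unique, so that these predicates speak of "the"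
    solution of the equation. *)
Definition cond_A1 (S sigma : R -> R) : Prop :=
  exists2 C : R, 0 < C & forall x y,
    `|S x - S y| <= C * `|x - y| /\ `|sigma x - sigma y| <= C * `|x - y|.

Definition cond_A2 (W : R -> Omega -> R) (x0 : R) (S sigma : R -> R) : Prop :=
  forall eps : R, 0 < eps ->
  forall X : R -> Omega -> R, sde_solution W x0 S sigma eps X ->
    (ereal_sup [set 'E_P[(fun w => `|X s w| ^+ 2)%R] | s in `[0%R, T]] < +oo)%E.

Definition cond_A3 (x0 : R) (S sigma : R -> R) : Prop :=
  forall x : R -> R, ode_solution x0 S x -> 0 < Sigma_of sigma x.

Definition conditions (W : R -> Omega -> R) (x0 : R) (S sigma : R -> R) : Prop :=
  [/\ cond_A1 S sigma, cond_A2 W x0 S sigma & cond_A3 x0 S sigma].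

Definition alternative_class (W : R -> Omega -> R) (x0 : R)
    (S0 sigma : R -> R) : set (R -> R) :=
  [set S | conditions W x0 S sigma /\
     forall x : R -> R, ode_solution x0 S x ->
       exists2 u : R, u \in `[0, T] &
         \int[mu]_(t in `[0, u]) (S (x t) - S0 (x t)) != 0].

Definition sampling_scheme (n : R -> nat) (t : R -> nat -> R) : Prop :=
  (forall eps : R, 0 < eps -> is_partition T (n eps) (t eps)) /\
  (fun eps => mesh (n eps) (t eps)) =o_ ((0 : R)^'+) (fun eps : R => eps ^+ 2).

Definition U_stat (S0 : R -> R) (eps : R) (n : nat) (t : nat -> R)
    (X : R -> Omega -> R) (u : R) (w : Omega) : R :=
  eps^-1 * \sum_(1 <= i < n.+1) \1_(`[0, u]%classic) (t i) *
    (X (t i) w - X (t i.-1) w - S0 (X (t i.-1) w) * `|t i - t i.-1|).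

Definition sup_U_stat (S0 : R -> R) (eps : R) (n : nat) (t : nat -> R)
    (X : R -> Omega -> R) (w : Omega) : R :=
  sup [set `|U_stat S0 eps n t X u w| | u in `[0, T]].

End stochastic_calculus.

(* Main.v *)
Require Import Defs.
From HB Require Import structures.
From mathcomp Require Import all_boot all_order all_algebra.
From mathcomp Require Import all_classical all_reals all_analysis.
From mathcomp Require Import measurable_realfun.
From mathcomp Require Import ring lra.
Import Order.TTheory GRing.Theory Num.Theory.
Import numFieldNormedType.Exports.

(** Under the alternative the observed process follows [S], whereas the statistic
    subtracts the drift [S0]. As [eps] tends to [0] the diffusion [X] stays within
    [O(eps)] of the limit path [xS], so the sum of the residuals up to time [u] is
    close to the integral over [[0, u]] of [S (xS s) - S0 (xS s)]. This integral
    does not vanish at some [u], and the statistic multiplies it by [eps^-1]: it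
    grows like [eps^-1], while its denominator stays close to a positive number.

    What has to be shown is that the noise is really of order [eps]. Write
    [X t = x0 + \int_0^t S (X s) ds + eps * Z t], where [Z] is the Ito integral of
    [sigma (X s)]. The crucial fact, [sde_noise_second_moment_le], is that the
    second moments of [Z t] are bounded uniformly in [t] and in small [eps]. The
    hypotheses only say that the second moments of [X] are finite for each [eps];
    this is enough for an absorption argument. On one hand,
    [ito_second_moment_le] bounds the second moment of [Z t] by the expected energy
    [b] of [sigma (X s)]. On the other hand, Gronwall's inequality, applied path by
    path in [perturbed_diffusion_energy_le], bounds [b] by a constant plus a multiple
    of [eps ^+ 2 * b]; for small [eps] this multiple is absorbed since [b] is
    finite.

    The Ito integral is given as a limit in probability of integrals of simple
    processes, so [ito_second_moment_le] is proved from the simple processes up,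
    with constants that are not sharp. For a simple process, adding one step adds
    a normal increment independent of the past
    ([second_moment_normal_increment_le]), whence a bound by the energy of the
    process ([simple_partial_adapted_energy_le]). As the approximation of the
    integrand holds in probability only, a simple process is stopped before its
    energy exceeds a level [K] ([simple_integral_truncated]), which changes its
    integral on an event of small probability. A Fatou lemma for convergence in
    probability ([second_moment_le_in_probability]) takes the limit.

    Given the moments of [Z], Gronwall's inequality and Markov's inequality show that the
    residual sums differ from their values along [xS] by [O(eps)] with large
    probability, uniformly in the grid ([residual_sum_drift_prob]); along [xS]
    they are Riemann sums, within a multiple of the mesh of the integral
    ([drift_sum_dist_le]). When the residual at [u] is within these errors and the
    estimator is close to its limit, the statistic exceeds any given [M] as soon
    as [eps] is small ([standardized_signal_gt]); this event has probability at
    least [3 / 4], which contradicts boundedness in probability. *)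

Set Implicit Arguments.
Unset Strict Implicit.
Unset Printing Implicit Defensive.
Local Open Scope classical_set_scope.
Local Open Scope ring_scope.

(** * Second moments of normal laws *)

Section normal_law.
Context {R : realType}.
Notation mu := (@lebesgue_measure R).
Implicit Types s m x : R.

(** The normal law is defined by its density with respect to [mu], which is
    therefore almost everywhere its Radon-Nikodym derivative; Gaussian integrals
    then become Lebesgue integrals that can be compared pointwise. *)
Lemma ge0_integral_normal_prob s (f : R -> R) :
    measurable_fun setT f -> (forall y, 0 <= f y) ->
  (\int[normal_prob 0 s]_y (f y)%:E = \int[mu]_y (f y * normal_pdf 0 s y)%:E)%E.
Proof.
move=> mf f0.
pose nu : {finite_measure set (measurableTypeR R) -> \bar R} := normal_prob 0 s.
have numu : nu `<< mu := normal_prob_dominates 0 s.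
have mpdf : measurable_fun setT (EFin \o normal_pdf 0 s).
  by apply/measurable_EFinP; exact: measurable_normal_pdf.
have iRN := Radon_Nikodym_SigmaFinite.f_integrable numu.
rewrite -[LHS](@Radon_Nikodym_SigmaFinite.change_of_variables _ _ _ nu mu numu
  (EFin \o f))//; last exact/measurable_EFinP.
apply: ae_eq_integral => //.
- apply: emeasurable_funM; first exact/measurable_EFinP.
  exact: measurable_int iRN.
- apply/measurable_EFinP; apply: measurable_funM => //.
  exact: measurable_normal_pdf.
- under [X in ae_eq _ _ _ X]eq_fun do rewrite EFinM.
  apply: ae_eqe_mul2l; apply: integral_ae_eq => //.
  by move=> E _ mE; rewrite -Radon_Nikodym_SigmaFinite.f_integral.
Qed.

(** The reflection [y |-> - y] preserves Lebesgue measure; it is what makes the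
    odd part of a Gaussian integrand disappear. *)
Lemma ge0_integral_oppr (f : R -> \bar R) :
    measurable_fun setT f -> (forall y, 0 <= f y)%E ->
  (\int[mu]_y f (- y)%R = \int[mu]_y f y)%E.
Proof.
move=> mf f0.
have mN : measurable_fun setT (-%R : measurableTypeR R -> measurableTypeR R).
  exact: oppr_measurable.
transitivity (\int[pushforward mu (-%R : _ -> measurableTypeR R)]_y f y)%E.
  by rewrite ge0_integral_pushforward.
by apply: eq_measure_integral => A mA _; exact: lebesgue_measureN.
Qed.

(** Put [z := y ^+ 2 / (4 * s ^+ 2)]. The density of standard deviation [s] has
    the shape [expR (- z) * expR (- z)], and [z * expR (- z) <= 1] leaves one
    factor [expR (- z)], the shape of the density of standard deviation
    [r := Num.sqrt 2 * s], whose total mass is [1]. The two peaks differ by the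
    factor [Num.sqrt 2 <= 2], whence [8 = 4 * 2]. The order [s ^+ 2] of the bound
    is all that the energy estimates below exploit. *)
Lemma normal_second_moment_le s : 0 < s ->
  (\int[normal_prob 0 s]_y (y ^+ 2)%:E <= (8 * s ^+ 2)%:E)%E.
Proof.
move=> s0; rewrite ge0_integral_normal_prob//; last first.
  by move=> y; rewrite sqr_ge0.
pose r := Num.sqrt 2 * s.
have r0 : 0 < r by rewrite mulr_gt0// sqrtr_gt0.
have r2 : r ^+ 2 = 2 * s ^+ 2 by rewrite exprMn sqr_sqrtr.
have pkr : normal_peak s = Num.sqrt 2 * normal_peak r.
  rewrite /normal_peak r2 (_ : 2 * s ^+ 2 * pi *+ 2 = 2 * (s ^+ 2 * pi *+ 2)); last by ring.
  rewrite (@sqrtrM _ 2)// invfM mulrA.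
  by rewrite mulfV ?mul1r// gt_eqF// sqrtr_gt0.
have pdf_le y : y ^+ 2 * normal_pdf 0 s y <= 8 * s ^+ 2 * normal_pdf 0 r y.
  rewrite !normal_pdfE ?gt_eqF//= pkr /normal_fun !subr0 r2.
  set z := y ^+ 2 / (4 * s ^+ 2).
  have -> : - y ^+ 2 / (s ^+ 2 *+ 2) = - z + - z.
    by rewrite /z; field; rewrite gt_eqF.
  have -> : - y ^+ 2 / (2 * s ^+ 2 *+ 2) = - z.
    by rewrite /z; field; rewrite gt_eqF.
  have -> : y ^+ 2 = z * (4 * s ^+ 2) by rewrite /z; field; rewrite gt_eqF.
  have z1 : z * expR (- z) <= 1.
    rewrite expRN ler_pdivrMr ?expR_gt0// mul1r.
    by apply: le_trans (expR_ge1Dx z); rewrite lerDr.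
  have s2 : Num.sqrt 2 <= 2 :> R.
    by rewrite -[leRHS](@ger0_norm _ 2)// -sqrtr_sqr ler_sqrt ?exprn_gt0//; nra.
  rewrite expRD.
  have pk0 := normal_peak_ge0 r.
  have e0 := expR_ge0 (- z).
  have z0 : 0 <= z by rewrite /z divr_ge0 ?sqr_ge0// mulr_ge0 ?sqr_ge0.
  have -> : z * (4 * s ^+ 2) * (Num.sqrt 2 * normal_peak r * (expR (- z) * expR (- z)))
    = (4 * s ^+ 2 * normal_peak r * expR (- z)) * (Num.sqrt 2 * (z * expR (- z))) by ring.
  have -> : 8 * s ^+ 2 * (normal_peak r * expR (- z)) =
    (4 * s ^+ 2 * normal_peak r * expR (- z)) * 2 by ring.
  apply: ler_wpM2l; first by rewrite mulr_ge0// mulr_ge0// mulr_ge0// sqr_ge0.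
  by rewrite -[leRHS]mulr1 ler_pM// ?sqrtr_ge0// mulr_ge0.
apply: (@le_trans _ _ (\int[mu]_y ((8 * s ^+ 2)%:E * (normal_pdf 0 r y)%:E))%E).
  apply: ge0_le_integral => //.
  - by move=> y _; rewrite lee_fin mulr_ge0 ?sqr_ge0 ?normal_pdf_ge0.
  - apply/measurable_EFinP; apply: measurable_funM; last exact: measurable_normal_pdf.
    exact: exprn_measurable.
  - under eq_fun do rewrite -EFinM; apply/measurable_EFinP.
    by apply: measurable_funM => //; exact: measurable_normal_pdf.
  - by move=> y _; rewrite -EFinM lee_fin.
rewrite ge0_integralZl//; last 3 first.
- by apply/measurable_EFinP; exact: measurable_normal_pdf.
- by move=> y _; rewrite lee_fin normal_pdf_ge0.
- by rewrite lee_fin mulr_ge0 ?sqr_ge0.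
by rewrite integral_normal_pdf mule1.
Qed.

(** The centred law is symmetric, so [x] may be replaced by [- x]; the mean of
    the two integrands is [m ^+ 2 + x ^+ 2 * y ^+ 2], without cross term. *)
Lemma normal_affine_second_moment_le s m x : 0 < s ->
  (\int[normal_prob 0 s]_y ((m + x * y) ^+ 2)%:E <=
   (m ^+ 2 + 8 * s ^+ 2 * x ^+ 2)%:E)%E.
Proof.
move=> s0.
have mq c : measurable_fun setT (fun y : R => (m + c * y) ^+ 2).
  by apply: measurable_funX; apply: measurable_funD => //; exact: measurable_funM.
have q0 c y : 0 <= (m + c * y) ^+ 2 by rewrite sqr_ge0.
have symq : (\int[normal_prob 0 s]_y ((m + x * y) ^+ 2)%:E =
    \int[normal_prob 0 s]_y ((m + (- x) * y) ^+ 2)%:E)%E.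
  transitivity (\int[mu]_y ((m + x * y) ^+ 2 * normal_pdf 0 s y)%:E)%E.
    by apply: ge0_integral_normal_prob; [exact: mq|exact: q0].
  transitivity (\int[mu]_y ((m + - x * y) ^+ 2 * normal_pdf 0 s y)%:E)%E; last first.
    by apply/esym/ge0_integral_normal_prob; [exact: mq|exact: q0].
  pose h y := ((m + x * y) ^+ 2 * normal_pdf 0 s y)%:E.
  rewrite -[LHS](@ge0_integral_oppr h).
  - apply: eq_integral => y _; rewrite /h mulrN mulNr.
    by rewrite !normal_pdfE ?gt_eqF//= /normal_fun !subr0 sqrrN.
  - apply/measurable_EFinP; apply: measurable_funM; first exact: mq.
    exact: measurable_normal_pdf.
  - by move=> y; rewrite lee_fin mulr_ge0// normal_pdf_ge0.
have sum_le : (2%:E * \int[normal_prob 0 s]_y ((m + x * y) ^+ 2)%:E <=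
    2%:E * (m ^+ 2 + 8 * s ^+ 2 * x ^+ 2)%:E)%E.
  rewrite [X in (X * _)%E](_ : _ = (1 + 1)%:E)// EFinD ge0_muleDl// !mul1e.
  rewrite {2}symq -ge0_integralD//; last 4 first.
  - by move=> y _; rewrite lee_fin.
  - by apply/measurable_EFinP; exact: mq.
  - by move=> y _; rewrite lee_fin.
  - by apply/measurable_EFinP; exact: mq.
  under eq_integral => y _.
    rewrite -EFinD (_ : _ + _ = 2 * m ^+ 2 + 2 * x ^+ 2 * y ^+ 2); last by ring.
    rewrite EFinD; over.
  have x0 : 0 <= 2 * x ^+ 2 by rewrite mulr_ge0// sqr_ge0.
  have m0 : 0 <= 2 * m ^+ 2 by rewrite mulr_ge0// sqr_ge0.
  rewrite ge0_integralD//; last 2 first.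
  - by move=> y _; rewrite lee_fin mulr_ge0// sqr_ge0.
  - apply/measurable_EFinP; exact: measurable_funM.
  rewrite integral_cst//= [X in ((_)%:E * X)%E](_ : _ = 1%E); last exact: probability_setT.
  rewrite mule1.
  under [X in (_ + X)%E]eq_integral do rewrite EFinM.
  rewrite ge0_integralZl//; last 2 first.
  - by apply/measurable_EFinP; exact: exprn_measurable.
  - by move=> y _; rewrite lee_fin sqr_ge0.
  apply: (@le_trans _ _ ((2 * m ^+ 2)%:E + (2 * x ^+ 2)%:E * (8 * s ^+ 2)%:E)%E).
    by rewrite leeD2l// lee_wpmul2l// normal_second_moment_le.
  by rewrite -!EFinM -!EFinD lee_fin; nra.
by rewrite lee_pmul2l in sum_le.
Qed.

End normal_law.

(** * Increments independent of the past *)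

Section independent_increment.
Context {R : realType} {d : measure_display} {Omega : measurableType d}.
Variable P : probability Omega R.

(** Makes the closure properties of measurable functions available for a
    sub-sigma-algebra, seen as the sigma-algebra of another measurable type. *)
Lemma measurable_wrtP (G : set_system Omega) (f : Omega -> R) :
  sigma_algebra [set: Omega] G ->
  measurable_wrt G f <-> measurable_fun [set: g_sigma_algebraType G] f.
Proof.
move=> sG; have GE : <<s G >> = G by exact: sigma_algebra_id.
split=> [mf _ B mB|mf _ [B mB <-]].
  by rewrite /measurable/= GE; apply: mf; exists B.
by have := mf measurableT B mB; rewrite /measurable/= GE.
Qed.

Lemma measurable_wrt_measurable_fun (G : set_system Omega) (f : Omega -> R) :
  G `<=` measurable -> measurable_wrt G f -> measurable_fun setT f.
Proof. by move=> Gm mf _ B mB; apply/Gm/mf; exists B. Qed.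

(** Independence of [g] from [G] says that the law of [((M, xi), g)] is the
    product of the law of [(M, xi)] and a normal law. Tonelli's theorem then
    freezes [M] and [xi], which leaves the Gaussian integral
    [normal_affine_second_moment_le]. This is the one place where the normality
    and the independence of the Wiener increments enter. *)
Lemma second_moment_normal_increment_le (G : set_system Omega)
    (M xi g : Omega -> R) (s : R) :
  sigma_algebra [set: Omega] G -> G `<=` measurable ->
  measurable_wrt G M -> measurable_wrt G xi -> measurable_fun setT g -> 0 < s ->
  (forall B, measurable B -> P [set w | B (g w)] = normal_prob 0 s B) ->
  (forall A B, G A -> measurable B ->
     P (A `&` [set w | B (g w)]) = (P A * P [set w | B (g w)])%E) ->
  (\int[P]_w ((M w + xi w * g w) ^+ 2)%:E <=
   \int[P]_w (M w ^+ 2)%:E + (8 * s ^+ 2)%:E * \int[P]_w (xi w ^+ 2)%:E)%E.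
Proof.
move=> sG Gm GM Gxi mg s0 gN indep.
have mM := measurable_wrt_measurable_fun Gm GM.
have mxi := measurable_wrt_measurable_fun Gm Gxi.
have GE : <<s G >> = G by exact: sigma_algebra_id.
pose V w := (M w, xi w).
have mV : measurable_fun setT V by exact/measurable_fun_pairP.
have GV C : measurable C -> G (V @^-1` C).
  have : measurable_fun [set: g_sigma_algebraType G] V.
    apply/measurable_fun_pairP; split.
      exact/(measurable_wrtP M sG).
    exact/(measurable_wrtP xi sG).
  by move=> /(_ measurableT C) + mC => /(_ mC); rewrite setTI /measurable/= GE.
set V' : {mfun Omega >-> (R * R)%type} := HB.pack V (isMeasurableFun.Build _ _ _ _ V mV).
pose g' : Omega -> measurableTypeR R := g.
have mg' : measurable_fun setT g' by exact: mg.
pose Vg w := (V w, g' w).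
have mVg : measurable_fun setT Vg by exact/measurable_fun_pairP.
pose m1 := distribution P V'.
pose N : probability (measurableTypeR R) R := normal_prob 0 s.
set Vg' : {mfun Omega >-> (R * R * measurableTypeR R)%type} := HB.pack Vg (isMeasurableFun.Build _ _ _ _ Vg mVg).
have lawE : forall X : set (R * R * measurableTypeR R), measurable X -> (m1 \x N)%E X = distribution P Vg' X.
  apply: product_measure_unique => A B mA mB /=.
  rewrite /distribution /pushforward/= /N -gN//; exact: (indep _ _ (GV _ mA) mB).
pose q (p : R * R * measurableTypeR R) := ((p.1.1 + p.1.2 * p.2) ^+ 2)%:E.
have mq : measurable_fun setT q.
  apply/measurable_EFinP; apply: measurable_funX; apply: measurable_funD.
    exact: measurableT_comp.
  by apply: measurable_funM => //; exact: measurableT_comp.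
have q0 p : (0 <= q p)%E by rewrite lee_fin sqr_ge0.
have -> : (\int[P]_w ((M w + xi w * g w) ^+ 2)%:E = \int[distribution P Vg']_p q p)%E.
  by rewrite ge0_integral_distribution.
rewrite (eq_measure_integral (m1 \x N)%E); last first.
  by move=> A mA _; exact: (esym (lawE A mA)).
rewrite fubini_tonelli1//.
have m2 : measurable_fun [set: R * R] (fun v : R * R => (v.1 ^+ 2)%:E).
  by apply/measurable_EFinP; apply: measurable_funX.
have m2' : measurable_fun [set: R * R] (fun v : R * R => (v.2 ^+ 2)%:E).
  by apply/measurable_EFinP; apply: measurable_funX.
have s8 : 0 <= 8 * s ^+ 2 by rewrite mulr_ge0// sqr_ge0.
apply: (@le_trans _ _ (\int[m1]_v ((v.1 ^+ 2)%:E + (8 * s ^+ 2)%:E * (v.2 ^+ 2)%:E))%E).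
  apply: ge0_le_integral => //.
  - by move=> v _; rewrite integral_ge0.
  - exact: measurable_fun_fubini_tonelli_F.
  - by apply: emeasurable_funD => //; exact: measurable_funeM.
  - by move=> v _; rewrite -EFinM -EFinD; exact: normal_affine_second_moment_le.
rewrite ge0_integralD//; last 3 first.
- by move=> v _; rewrite lee_fin sqr_ge0.
- by move=> v _; rewrite mule_ge0// lee_fin sqr_ge0.
- exact: measurable_funeM.
rewrite ge0_integralZl//; last by move=> v _; rewrite lee_fin sqr_ge0.
rewrite !ge0_integral_distribution//.
- by move=> v; rewrite lee_fin sqr_ge0.
- by move=> v; rewrite lee_fin sqr_ge0.
Qed.
End independent_increment.

(** * Integrals of simple processes *)

Section partition_theory.
Context {R : realType}.
Implicit Types (T : R) (n : nat) (s : nat -> R).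

Lemma partition_le T n s : is_partition T n s ->
  forall i j, (i <= j)%N -> (j <= n)%N -> s i <= s j.
Proof.
move=> [_ _ sS] i j; elim: j => [|j IH]; first by rewrite leqn0 => /eqP ->.
rewrite leq_eqVlt => /predU1P[->//|ij] jn.
by rewrite (le_trans (IH ij (ltnW jn)))// ltW// sS.
Qed.

Lemma partition_ge0 T n s : is_partition T n s ->
  forall i, (i <= n)%N -> 0 <= s i.
Proof. by move=> ps i ni; have [<- _ _] := ps; exact: (partition_le ps). Qed.

Lemma partition_leT T n s : is_partition T n s ->
  forall i, (i <= n)%N -> s i <= T.
Proof. by move=> ps i ni; have [_ <- _] := ps; exact: (partition_le ps). Qed.

End partition_theory.

Section simple_integral.
Context {R : realType} {d : measure_display} {Omega : measurableType d}.
Variables (P : probability Omega R) (T : R) (F : R -> set_system Omega).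
Variable W : R -> Omega -> R.
Hypothesis hF : is_filtration T F.
Hypothesis hW : is_wiener P T F W.
Implicit Type H : @simple_process R d Omega.

Lemma filtration_measurable_fun t (f : Omega -> R) : 0 <= t <= T ->
  measurable_wrt (F t) f -> measurable_fun setT f.
Proof.
move=> t0T; have [_ Fm] := hF.1 t t0T.
exact: measurable_wrt_measurable_fun.
Qed.

Lemma filtration_le s t (f : Omega -> R) : 0 <= s -> s <= t -> t <= T ->
  measurable_wrt (F s) f -> measurable_wrt (F t) f.
Proof. by move=> s0 st tT /subset_trans; apply; exact: hF.2. Qed.

Definition simple_energy H (m : nat) (w : Omega) : R :=
  \sum_(i < m) sp_coef H i w ^+ 2 * (sp_grid H i.+1 - sp_grid H i).

(** The integral up to time [t] of the first [m] steps of [H]; all the steps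
    together give [simple_integral], and [m] is what inductions run over. *)
Definition simple_partial H (m : nat) (t : R) (w : Omega) : R :=
  \sum_(i < m) sp_coef H i w *
    (W (Num.min (sp_grid H i.+1) t) w - W (Num.min (sp_grid H i) t) w).

Lemma simple_coef_measurable H i : simple_adapted T F H -> (i < sp_size H)%N ->
  measurable_fun setT (sp_coef H i).
Proof.
move=> [ps Fxi _] iH; apply: (@filtration_measurable_fun (sp_grid H i)).
  by rewrite (partition_ge0 ps) ?(partition_leT ps)// ltnW.
exact: Fxi.
Qed.

Lemma simple_energy_measurable H m : simple_adapted T F H -> (m <= sp_size H)%N ->
  measurable_fun setT (simple_energy H m).
Proof.
move=> aH; elim: m => [|m IH] mH.
  by rewrite (_ : simple_energy H 0 = cst 0)//; apply/funext => w; rewrite /simple_energy big_ord0.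
rewrite (_ : simple_energy H m.+1 = simple_energy H m \+
    (fun w => sp_coef H m w ^+ 2 * (sp_grid H m.+1 - sp_grid H m))); last first.
  by apply/funext => w; rewrite /simple_energy big_ord_recr.
apply: measurable_funD; first exact/IH/ltnW.
by apply: measurable_funM => //; apply: measurable_funX; exact: simple_coef_measurable.
Qed.

Lemma simple_energy_ge0 H m w : simple_adapted T F H -> (m <= sp_size H)%N ->
  0 <= simple_energy H m w.
Proof.
move=> [ps _ _] mH; apply: sumr_ge0 => i _; rewrite mulr_ge0 ?sqr_ge0// subr_ge0.
by rewrite (partition_le ps)// (leq_trans _ mH).
Qed.

(** Induction on [m]. Seen from time [sp_grid H m], the partial sum and the next
    coefficient are known and the next increment of [W] is normal and
    independent, so that one more step costs at most [8] times the second moment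
    of the coefficient times the length of the step. Adaptedness is proved along
    with the bound, because it is what makes the partial sum known at the next
    step. A step that begins after [t] contributes nothing. *)
Lemma simple_partial_adapted_energy_le H t m :
  simple_adapted T F H -> 0 <= t <= T -> (m <= sp_size H)%N ->
  measurable_wrt (F (Num.min (sp_grid H m) t)) (simple_partial H m t) /\
  (\int[P]_w (simple_partial H m t w ^+ 2)%:E <=
    8%:E * \int[P]_w (simple_energy H m w)%:E)%E.
Proof.
move=> aH /andP[t0 tT]; have [ps Fxi _] := aH.
have [adW _ _ lawW indW] := hW.
elim: m => [_|m IH mH].
  split.
    have minT : 0 <= Num.min (sp_grid H 0) t <= T.
      by rewrite le_min t0 (partition_ge0 ps)//= ge_min tT orbT.
    rewrite measurable_wrtP; last by have [] := hF.1 _ minT.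
    rewrite (_ : simple_partial H 0 t = cst 0)//.
    by apply/funext => w; rewrite /simple_partial big_ord0.
  under eq_integral do rewrite /simple_partial big_ord0 expr0n/=.
  rewrite integral0 mule_ge0// integral_ge0// => w _.
  by rewrite lee_fin simple_energy_ge0.
have [Mm Me] := IH (ltnW mH).
have s0 := partition_ge0 ps (ltnW mH).
have sS : sp_grid H m < sp_grid H m.+1 by have [_ _] := ps; apply.
have energyS : (\int[P]_w (simple_energy H m.+1 w)%:E =
    \int[P]_w (simple_energy H m w)%:E +
    (sp_grid H m.+1 - sp_grid H m)%:E * \int[P]_w (sp_coef H m w ^+ 2)%:E)%E.
  have ds : 0 <= sp_grid H m.+1 - sp_grid H m by rewrite subr_ge0 ltW.
  have mx : measurable_fun setT (fun w => (sp_coef H m w ^+ 2)%:E).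
    by apply/measurable_EFinP; apply: measurable_funX; exact: simple_coef_measurable.
  rewrite -ge0_integralZl//; last by move=> w _; rewrite lee_fin sqr_ge0.
  rewrite -ge0_integralD//; last 4 first.
  - by move=> w _; rewrite lee_fin simple_energy_ge0// ltnW.
  - by apply/measurable_EFinP; exact/simple_energy_measurable/ltnW.
  - by move=> w _; rewrite mule_ge0// lee_fin sqr_ge0.
  - exact: measurable_funeM.
  apply: eq_integral => w _; rewrite -EFinM -EFinD; congr EFin.
  by rewrite /simple_energy big_ord_recr/= [X in _ + X]mulrC.
have [ts|st] := leP t (sp_grid H m).
  have ts' : t <= sp_grid H m.+1 by rewrite (le_trans ts)// ltW.
  have MS : simple_partial H m.+1 t = simple_partial H m t.
    apply/funext => w; rewrite /simple_partial big_ord_recr/=.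
    by rewrite !min_r// subrr mulr0 addr0.
  rewrite MS min_r//; split; first by move: Mm; rewrite min_r.
  rewrite (le_trans Me)// energyS lee_wpmul2l// leeDl// mule_ge0//.
    by rewrite lee_fin subr_ge0 ltW.
  by apply: integral_ge0 => w _; rewrite lee_fin sqr_ge0.
rewrite min_l ?(ltW st)// in Mm.
set u := Num.min _ t.
have su : sp_grid H m < u by rewrite lt_min sS st.
have uT : u <= T by rewrite ge_min tT orbT.
have u0 : 0 <= u by rewrite (le_trans s0)// ltW.
have MS w : simple_partial H m.+1 t w =
    simple_partial H m t w + sp_coef H m w * (W u w - W (sp_grid H m) w).
  by rewrite /simple_partial big_ord_recr/= -/u (min_l (ltW st)).
have mT : 0 <= sp_grid H m <= T by rewrite s0 (le_trans (ltW su)).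
have uTb : 0 <= u <= T by rewrite u0.
have [sGm Gmm] := hF.1 _ mT.
have [sGu Gum] := hF.1 _ uTb.
have wu (f : Omega -> R) : measurable_wrt (F (sp_grid H m)) f ->
    measurable_fun [set: g_sigma_algebraType (F u)] f.
  by move=> mf; rewrite -measurable_wrtP//; apply: filtration_le mf => //; exact: ltW.
split.
  rewrite measurable_wrtP// (_ : simple_partial _ _ _ = fun w =>
    simple_partial H m t w + sp_coef H m w * (W u w - W (sp_grid H m) w)); last first.
    exact/funext.
  apply: measurable_funD; first exact: wu.
  apply: measurable_funM; first exact: (wu _ (Fxi _ mH)).
  apply: measurable_funB; first by rewrite -measurable_wrtP//; exact: adW.
  by apply: wu; exact: adW.
under eq_integral do rewrite MS.
apply: le_trans.
  apply: (@second_moment_normal_increment_le _ _ _ P (F (sp_grid H m))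
    (simple_partial H m t) (sp_coef H m) (fun w => W u w - W (sp_grid H m) w)
    (Num.sqrt (u - sp_grid H m))) => //.
  - exact: Fxi.
  - by apply: measurable_funB;
      [exact: (filtration_measurable_fun uTb (adW _ uTb))
      |exact: (filtration_measurable_fun mT (adW _ mT))].
  - by rewrite sqrtr_gt0 subr_gt0.
  - by move=> B mB; exact: lawW.
  - by move=> A B FA mB; exact: indW.
rewrite energyS sqr_sqrtr ?subr_ge0 ?(ltW su)//.
have b0 : (0 <= \int[P]_w (simple_energy H m w)%:E)%E.
  by apply: integral_ge0 => w _; rewrite lee_fin simple_energy_ge0// ltnW.
have c0 : (0 <= \int[P]_w (sp_coef H m w ^+ 2)%:E)%E.
  by apply: integral_ge0 => w _; rewrite lee_fin sqr_ge0.
set b := integral _ _ (fun w => (simple_energy _ _ w)%:E) in b0 Me *.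
set c := integral _ _ (fun w => (sp_coef H m w ^+ 2)%:E) in c0 *.
have kc0 : (0 <= (sp_grid H m.+1 - sp_grid H m)%:E * c)%E.
  by rewrite mule_ge0// lee_fin subr_ge0 ltW.
rewrite (ge0_muleDr _ b0 kc0).
rewrite leeD// muleA -EFinM; apply: lee_wpmul2r => //.
by rewrite lee_fin ler_wpM2l// lerD2r ge_min lexx.
Qed.

End simple_integral.

(** * Truncation of simple processes by their energy *)

Section truncation.
Context {R : realType} {d : measure_display} {Omega : measurableType d}.
Variables (P : probability Omega R) (T : R) (F : R -> set_system Omega).
Variable W : R -> Omega -> R.
Hypothesis hF : is_filtration T F.
Hypothesis hW : is_wiener P T F W.
Implicit Type H : @simple_process R d Omega.

(** The process stopped just before its energy exceeds [K]. *)
Definition simple_truncate (K : R) H : simple_process :=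
  SimpleProcess (sp_size H) (sp_grid H)
    (fun i w => if simple_energy H i.+1 w <= K then sp_coef H i w else 0).

Lemma simple_energyS H m w : simple_energy H m.+1 w =
  simple_energy H m w + sp_coef H m w ^+ 2 * (sp_grid H m.+1 - sp_grid H m).
Proof. by rewrite /simple_energy big_ord_recr. Qed.

Lemma simple_energy_le H i j w : simple_adapted T F H ->
  (i <= j)%N -> (j <= sp_size H)%N -> simple_energy H i w <= simple_energy H j w.
Proof.
move=> [[_ _ sS] _ _]; elim: j => [|j IH]; first by rewrite leqn0 => /eqP ->.
rewrite leq_eqVlt => /predU1P[->//|ij] jn.
rewrite (le_trans (IH ij (ltnW jn)))// simple_energyS lerDl mulr_ge0 ?sqr_ge0//.
by rewrite subr_ge0 ltW// sS.
Qed.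

(** The energy up to [sp_grid H i.+1] involves the coefficients of index at most
    [i], hence is known at time [sp_grid H i]: deciding whether to keep the
    [i]-th coefficient does not look into the future. *)
Lemma simple_truncate_adapted K H :
  simple_adapted T F H -> simple_adapted T F (simple_truncate K H).
Proof.
move=> aH; have [ps Fxi bxi] := aH; split => //=; last first.
  move=> i /bxi[B hB]; exists `|B| => w; case: ifPn => _.
    by rewrite (le_trans (hB w))// ler_norm.
  by rewrite normr0.
move=> i iH.
have i0T j : (j < sp_size H)%N -> 0 <= sp_grid H j <= T.
  by move=> jH; rewrite (partition_ge0 ps) ?(partition_leT ps)// ltnW.
have [sG _] := hF.1 _ (i0T i iH).
have mxi j : (j <= i)%N ->
    measurable_fun [set: g_sigma_algebraType (F (sp_grid H i))] (sp_coef H j).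
  move=> ji; have jH := leq_ltn_trans ji iH.
  rewrite -measurable_wrtP//; apply: (filtration_le hF) (Fxi _ jH).
  - by case/andP: (i0T j jH).
  - by rewrite (partition_le ps)// ltnW.
  - by case/andP: (i0T i iH).
have mE j : (j <= i.+1)%N ->
    measurable_fun [set: g_sigma_algebraType (F (sp_grid H i))] (simple_energy H j).
  elim: j => [_|j IH ji].
    rewrite (_ : simple_energy H 0 = cst 0)//.
    by apply/funext => w; rewrite /simple_energy big_ord0.
  rewrite (_ : simple_energy H j.+1 = fun w => simple_energy H j w +
      sp_coef H j w ^+ 2 * (sp_grid H j.+1 - sp_grid H j)); last first.
    by apply/funext => w; rewrite simple_energyS.
  apply: measurable_funD; first exact: (IH (ltnW ji)).
  by apply: measurable_funM => //; apply: measurable_funX; exact: mxi.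
rewrite measurable_wrtP//; apply: measurable_fun_ifT => //; last exact: mxi.
by apply: measurable_fun_ler => //; exact: mE.
Qed.

Lemma simple_truncate_energy_le K H m w : 0 <= K -> simple_adapted T F H ->
  (m <= sp_size H)%N ->
  simple_energy (simple_truncate K H) m w <= Num.min (simple_energy H m w) K.
Proof.
move=> K0 aH; elim: m => [_|m IH mH].
  by rewrite /simple_energy !big_ord0 le_min lexx.
have {}IH := IH (ltnW mH).
rewrite simple_energyS /=; case: ifPn => [eK|].
  rewrite (min_l eK) simple_energyS lerD2r.
  by apply: le_trans IH _; rewrite ge_min lexx.
rewrite -ltNge => Ke; rewrite expr0n/= mul0r addr0 (min_r (ltW Ke)).
by apply: le_trans IH _; rewrite ge_min lexx orbT.
Qed.

(** An Ito integral is a limit in probability of integrals of simple processes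
    that approximate the integrand in probability only, so nothing controls the
    expected energy of the latter. The truncated process has energy at most [K],
    and its integral [J] differs from the original one only on the event that
    the energy exceeds [K]. *)
Lemma simple_integral_truncated K H t : 0 <= K -> 0 <= t <= T ->
  simple_adapted T F H ->
  exists J : Omega -> R, [/\ measurable_fun setT J,
    (\int[P]_w (J w ^+ 2)%:E <=
      8%:E * \int[P]_w (Num.min (simple_energy H (sp_size H) w) K)%:E)%E &
    forall w, simple_energy H (sp_size H) w <= K -> J w = simple_integral W H t w].
Proof.
move=> K0 t0T aH; have aK := simple_truncate_adapted K aH.
have [ps _ _] := aH.
have [JF Je] := simple_partial_adapted_energy_le hF hW aK t0T (leqnn _).
have HTt : Num.min (sp_grid H (sp_size H)) t = t.
  by have [_ -> _] := ps; rewrite min_r//; case/andP: t0T.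
rewrite [sp_grid _ _]/= [sp_size _]/= HTt in JF.
exists (simple_partial W (simple_truncate K H) (sp_size H) t); split.
- exact: (filtration_measurable_fun hF t0T JF).
- apply: (le_trans Je); apply: lee_wpmul2l => //.
  apply: ge0_le_integral => //.
  + by move=> w _; rewrite lee_fin (simple_energy_ge0 _ aK).
  + by apply/measurable_EFinP; exact: (simple_energy_measurable hF aK).
  + apply/measurable_EFinP; apply: measurable_minr => //.
    exact: (simple_energy_measurable hF aH).
  + by move=> w _; rewrite lee_fin; exact: simple_truncate_energy_le.
- move=> w eK; rewrite /simple_partial /simple_integral/=.
  apply: eq_bigr => i _; rewrite ifT// (le_trans _ eK)//.
  exact: simple_energy_le aH (ltn_ord i) _.
Qed.

Lemma simple_integral_measurable H t : 0 <= t <= T -> simple_adapted T F H ->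
  measurable_fun setT (simple_integral W H t).
Proof.
move=> t0T aH; have [ps _ _] := aH.
have [+ _] := simple_partial_adapted_energy_le hF hW aH t0T (leqnn _).
rewrite min_r; first exact: (filtration_measurable_fun hF t0T).
by have [_ -> _] := ps; case/andP: t0T.
Qed.

End truncation.

(** * Integration over time and space *)

Section sections.
Context {R : realType} {d : measure_display} {Omega : measurableType d}.
Variable P : probability Omega R.
Notation mu := (@lebesgue_measure R).
Implicit Types (D : set R) (f : R * Omega -> \bar R).

Lemma measurable_fun_section d' (U : measurableType d') D (f : R * Omega -> U) w :
  measurable D -> measurable_fun (D `*` [set: Omega]) f ->
  measurable_fun D (fun s => f (s, w)).
Proof.
move=> mD mf; apply: (@measurable_comp _ _ _ _ _ _ (D `*` [set: Omega]) f) => //.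
- exact: measurableX.
- by move=> _ [s Ds <-].
- by apply: measurable_funTS; exact: measurable_pair2.
Qed.

(** Product measures live on the whole of [R * Omega]; extending [f] by [0]
    outside [D] transfers their theorems to a time window [D]. *)
Lemma integral_section_patch D f w :
  (\int[mu]_(s in D) f (s, w) =
   \int[mu]_s (f \_ (D `*` [set: Omega])) (s, w))%E.
Proof.
rewrite integral_mkcond; apply: eq_integral => s _.
rewrite !patchE; congr (if _ then _ else _).
by apply/idP/idP => [/set_mem Ds|/set_mem[/= Ds _]]; exact/mem_set.
Qed.

Lemma measurable_integral_section D f : measurable D ->
  measurable_fun (D `*` [set: Omega]) f -> (forall p, 0 <= f p)%E ->
  measurable_fun [set: Omega] (fun w => \int[mu]_(s in D) f (s, w))%E.
Proof.
move=> mD mf f0; under eq_fun do rewrite integral_section_patch.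
apply: (@measurable_fun_fubini_tonelli_G _ _ (measurableTypeR R) Omega R mu
  (f \_ (D `*` [set: Omega]))) => //.
  by apply/(measurable_restrictT _ (measurableX mD measurableT)); exact: mf.
by move=> p; rewrite patchE; case: ifP.
Qed.

Lemma measurable_integral_time_section D f : measurable D ->
  measurable_fun (D `*` [set: Omega]) f -> (forall p, 0 <= f p)%E ->
  measurable_fun D (fun s => \int[P]_w f (s, w))%E.
Proof.
move=> mD mf f0.
have mfD : measurable_fun D (fubini_F P (f \_ (D `*` [set: Omega]))).
  apply: measurable_funTS.
  apply: (@measurable_fun_fubini_tonelli_F _ _ (measurableTypeR R) Omega R P).
    by apply/(measurable_restrictT _ (measurableX mD measurableT)); exact: mf.
  by move=> p; rewrite patchE; case: ifP.
apply: eq_measurable_fun mfD => s sD; apply: eq_integral => w _.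
by rewrite patchE ifT// inE; split => //; exact: set_mem.
Qed.

Lemma tonelli_section D f : measurable D ->
  measurable_fun (D `*` [set: Omega]) f -> (forall p, 0 <= f p)%E ->
  (\int[P]_w \int[mu]_(s in D) f (s, w) = \int[mu]_(s in D) \int[P]_w f (s, w))%E.
Proof.
move=> mD mf f0; under eq_integral do rewrite integral_section_patch.
transitivity (\int[mu]_s \int[P]_w (f \_ (D `*` [set: Omega])) (s, w))%E.
  apply/esym/(@fubini_tonelli _ _ (measurableTypeR R) Omega R mu P).
    by apply/(measurable_restrictT _ (measurableX mD measurableT)); exact: mf.
  by move=> p; rewrite patchE; case: ifP.
rewrite [RHS]integral_mkcond; apply: eq_integral => s _; rewrite patchE.
case: ifPn => sD.
  apply: eq_integral => w _; rewrite patchE ifT// inE; split => //.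
  exact: set_mem.
rewrite integral0_eq// => w _; rewrite patchE ifF//.
by apply: contraNF sD; rewrite !inE => -[].
Qed.

End sections.

(** * Fatou's lemma in probability *)

Section fatou_in_probability.
Context {R : realType} {d : measure_display} {Omega : measurableType d}.
Variable P : probability Omega R.

(** Where [`|J - Z| < e], one has [Z ^+ 2 <= 2 * J ^+ 2 + 2 * e ^+ 2]; elsewhere,
    on a set of probability at most [e], the truncation at [N] takes over. *)
Lemma truncated_second_moment_le (Z J : Omega -> R) (b e N : R) :
  measurable_fun setT Z -> measurable_fun setT J -> 0 < e -> 0 <= N ->
  (\int[P]_w (J w ^+ 2)%:E <= (b + e)%:E)%E ->
  (P [set w | (e <= `|J w - Z w|)%R] <= e%:E)%E ->
  (\int[P]_w (Num.min (Z w ^+ 2) N)%:E <= (2 * b + e * (2 + 2 * e + N))%:E)%E.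
Proof.
move=> mZ mJ e0 N0 Jb Pe; set A := [set w | _] in Pe.
have mA : measurable A.
  rewrite /A -[X in measurable X]setTI; apply: measurable_fun_le => //.
  by apply: measurableT_comp => //; exact: measurable_funB.
apply: (@le_trans _ _ (\int[P]_w ((2 * J w ^+ 2)%:E + ((2 * e ^+ 2)%:E + (N * \1_A w)%:E)))%E).
  apply: ge0_le_integral => //.
  - by move=> w _; rewrite lee_fin le_min sqr_ge0.
  - by apply/measurable_EFinP; apply: measurable_minr => //; exact: measurable_funX.
  - apply: emeasurable_funD; apply/measurable_EFinP.
      by apply: measurable_funM => //; exact: measurable_funX.
    by apply: measurable_funD => //; exact: measurable_funM.
  - move=> w _; rewrite -!EFinD lee_fin indicE; case: (boolP (w \in A)) => wA.
      rewrite mulr1; apply: (@le_trans _ _ N); first by rewrite ge_min lexx orbT.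
      by rewrite addrA lerDr addr_ge0// mulr_ge0// sqr_ge0.
    have /ltW : `|J w - Z w| < e.
      by rewrite ltNge; apply: contra wA; rewrite inE.
    rewrite ler_norml mulr0 addr0 => /andP[h1 h2].
    apply: (@le_trans _ _ (Z w ^+ 2)); first by rewrite ge_min lexx.
    have := sqr_ge0 (2 * J w - Z w).
    have : (J w - Z w) ^+ 2 <= e ^+ 2.
      by rewrite -ler_sqrt ?sqr_ge0// !sqrtr_sqr (ger0_norm (ltW e0)) ler_norml h1.
    by nra.
rewrite ge0_integralD//; last 4 first.
- by move=> w _; rewrite lee_fin mulr_ge0// sqr_ge0.
- apply/measurable_EFinP.
  by apply: measurable_funM => //; exact: measurable_funX.
- by move=> w _; apply: adde_ge0; rewrite lee_fin mulr_ge0// sqr_ge0.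
- by apply: emeasurable_funD => //; apply/measurable_EFinP; exact: measurable_funM.
rewrite ge0_integralD//; last 3 first.
- by move=> w _; rewrite lee_fin mulr_ge0// sqr_ge0.
- by move=> w _; rewrite lee_fin mulr_ge0.
- by apply/measurable_EFinP; exact: measurable_funM.
rewrite integral_cst//= probability_setT mule1.
under eq_integral do rewrite EFinM.
rewrite ge0_integralZl//; last 2 first.
- by apply/measurable_EFinP; exact: measurable_funX.
- by move=> w _; rewrite lee_fin sqr_ge0.
under [X in (_ + (_ + X))%E]eq_integral do rewrite EFinM.
rewrite ge0_integralZl//; last by apply/measurable_EFinP.
rewrite integral_indic// setIT.
apply: (@le_trans _ _ (2%:E * (b + e)%:E + ((2 * e ^+ 2)%:E + N%:E * e%:E))%E).
  by rewrite leeD// ?lee_wpmul2l// leeD2l// lee_wpmul2l.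
by rewrite -!EFinM -!EFinD lee_fin; nra.
Qed.

(** Fatou's lemma for convergence in probability. For a fixed level [N] the
    errors of the preceding lemma vanish with [e]; then [N] goes to infinity by
    monotone convergence. The factor [2] is the price of comparing [Z] with a
    nearby [J] directly, instead of extracting an almost surely convergent
    subsequence. *)
Lemma second_moment_le_in_probability (Z : Omega -> R) (b : R) :
  measurable_fun setT Z ->
  (forall e, 0 < e -> exists J : Omega -> R, [/\ measurable_fun setT J,
     (\int[P]_w (J w ^+ 2)%:E <= (b + e)%:E)%E &
     (P [set w | (e <= `|J w - Z w|)%R] <= e%:E)%E]) ->
  (\int[P]_w (Z w ^+ 2)%:E <= (2 * b)%:E)%E.
Proof.
move=> mZ hJ.
have trunc (N : R) : 0 <= N -> (\int[P]_w (Num.min (Z w ^+ 2) N)%:E <= (2 * b)%:E)%E.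
  move=> N0; apply/lee_addgt0Pr => a a0.
  pose e := Num.min 1 (a / (4 + N)).
  have N4 : 0 < 4 + N by rewrite ltr_wpDr.
  have e0 : 0 < e by rewrite lt_min ltr01 divr_gt0.
  have [J [mJ Jb Pe]] := hJ e e0.
  apply: le_trans (truncated_second_moment_le mZ mJ e0 N0 Jb Pe) _.
  rewrite -EFinD lee_fin lerD2l.
  have e1 : e <= 1 by rewrite ge_min lexx.
  have : e * (4 + N) <= a by rewrite -ler_pdivlMr// ge_min lexx orbT.
  by apply: le_trans; rewrite (ler_wpM2l (ltW e0))//; lra.
pose g (n : nat) w := (Num.min (Z w ^+ 2) n%:R)%:E.
have gZw w : g ^~ w @ \oo --> (Z w ^+ 2)%:E.
  apply: cvg_near_cst; near=> n; rewrite /g min_l//.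
  by near: n; exact: nbhs_infty_ger.
have gZ : (\int[P]_w g n w)%E @[n --> \oo] --> (\int[P]_w (Z w ^+ 2)%:E)%E.
  rewrite (_ : (fun w => (Z w ^+ 2)%:E) = fun w => limn (g ^~ w)); last first.
    by apply/funext => w; apply/esym/cvg_lim.
  apply: cvg_monotone_convergence => //.
  - move=> n; apply/measurable_EFinP; apply: measurable_minr => //.
    exact: measurable_funX.
  - by move=> n w _; rewrite lee_fin le_min sqr_ge0 ler0n.
  - move=> w _ n m nm; rewrite lee_fin le_min ge_min lexx/= ge_min.
    by rewrite ler_nat nm orbT.
rewrite -(cvg_lim _ gZ)//; apply: lime_le; first by apply/cvg_ex; eexists; exact: gZ.
by apply: nearW => n; exact: trunc.
Unshelve. all: by end_near. Qed.

End fatou_in_probability.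

(** * A second moment bound for Ito integrals *)

(** At most one term is nonzero, so the square has no cross terms. *)
Lemma sqr_sum_disjoint (R : pzRingType) (I : finType) (a : I -> R) (b : pred I) :
  (forall i j, b i -> b j -> i = j) ->
  (\sum_i a i * (b i)%:R) ^+ 2 = \sum_i a i ^+ 2 * (b i)%:R.
Proof.
move=> b_inj; have [[i bi]|nb] := pselect (exists i, b i).
  have bN j : j != i -> b j = false.
    by move=> ji; apply/negP => bj; move: ji; rewrite (b_inj _ _ bj bi) eqxx.
  rewrite (bigD1 i)//= big1 => [|j /bN ->]; last by rewrite mulr0.
  rewrite (bigD1 i)//= big1 => [|j /bN ->]; last by rewrite mulr0.
  by rewrite bi !mulr1 !addr0.
have bN i : b i = false by apply/negP => bi; apply: nb; exists i.
by rewrite !big1 ?expr0n// => i _; rewrite bN mulr0.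
Qed.

Lemma cvg0_near_le (R : realType) (I : Type) (L : set_system I) {FL : Filter L}
    (f : I -> \bar R) (e : R) : 0 < e -> f @ L --> 0%E ->
  \forall i \near L, (f i <= e%:E)%E.
Proof.
move=> e0 f0; have nbhs_lt : nbhs (0%E : \bar R) [set y | y < e%:E]%E.
  have e0' : (0 < e%:E)%E by rewrite lte_fin.
  exact: (open_ereal_lt' e0').
have L_lt : L (f @^-1` [set y | y < e%:E]%E) := f0 _ nbhs_lt.
by apply: (filterS _ L_lt) => i /ltW.
Qed.

Section ito_second_moment.
Context {R : realType} {d : measure_display} {Omega : measurableType d}.
Variables (P : probability Omega R) (T : R) (F : R -> set_system Omega).
Variable W : R -> Omega -> R.
Hypothesis hF : is_filtration T F.
Hypothesis hW : is_wiener P T F W.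
Implicit Type H : @simple_process R d Omega.
Notation mu := (@lebesgue_measure R).

Lemma simple_eval_sqr H s w : is_partition T (sp_size H) (sp_grid H) ->
  simple_eval H s w ^+ 2 = \sum_(i < sp_size H)
    sp_coef H i w ^+ 2 * \1_(`]sp_grid H i, sp_grid H i.+1]%classic) s.
Proof.
move=> ps; rewrite /simple_eval.
under eq_bigr do rewrite indicE.
under [RHS]eq_bigr do rewrite indicE.
apply: sqr_sum_disjoint => i j; rewrite !inE/= !in_itv/= => /andP[i1 i2] /andP[j1 j2].
apply/val_inj/eqP; rewrite eqn_leq /=; apply/andP; split; rewrite leqNgt; apply/negP => ij.
  have := partition_le ps ij (ltnW (ltn_ord i)).
  by rewrite leNgt (lt_le_trans i1).
have := partition_le ps ij (ltnW (ltn_ord j)).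
by rewrite leNgt (lt_le_trans j1).
Qed.

(** The intervals of the grid are disjoint, so the square of [simple_eval]
    integrates term by term. *)
Lemma simple_energyE H w : is_partition T (sp_size H) (sp_grid H) ->
  ((simple_energy H (sp_size H) w)%:E =
   \int[mu]_(s in `[0%R, T]) (simple_eval H s w ^+ 2)%:E)%E.
Proof.
move=> ps; under eq_integral do rewrite simple_eval_sqr// -sumEFin.
rewrite ge0_integral_sum//; last 2 first.
  move=> i; apply/measurable_EFinP; apply: measurable_funM => //.
  by move=> i s _; rewrite lee_fin mulr_ge0 ?sqr_ge0.
rewrite /simple_energy -sumEFin; apply: eq_bigr => i _.
under eq_integral do rewrite EFinM.
rewrite ge0_integralZl//; last 2 first.
  by apply/measurable_EFinP.
  by rewrite lee_fin sqr_ge0.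
rewrite integral_indic// setIidl; last first.
  move=> s /=; rewrite !in_itv/= => /andP[s1 s2].
  rewrite (le_trans _ (ltW s1)) ?(partition_ge0 ps) 1?ltnW//=.
  by rewrite (le_trans s2)// (partition_leT ps).
have [_ _ /(_ _ (ltn_ord i)) sS] := ps.
by rewrite /= lebesgue_measure_itv/= lte_fin sS EFinM EFinB.
Qed.

Lemma simple_eval_measurable H : simple_adapted T F H ->
  measurable_fun (`[0, T] `*` [set: Omega]) (fun p => simple_eval H p.1 p.2).
Proof.
move=> aH; apply: measurable_sum => i; apply: measurable_funTS.
apply: measurable_funM.
  apply: (measurableT_comp _ measurable_snd).
  exact: (simple_coef_measurable hF aH (ltn_ord i)).
by apply: (measurableT_comp _ measurable_fst).
Qed.

(** A one-sided substitute for the Ito isometry. The constant is [2 * 8 * 2]: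
    [2] from Fatou's lemma in probability, [8] from the energy bound for simple
    processes, and [2] from bounding the energy of the approximating process by
    twice that of [Y] plus twice that of the difference. *)
Lemma ito_second_moment_le Y Z t : 0 <= t <= T -> ito_integral P T F W Y Z ->
  (\int[P]_w \int[mu]_(s in `[0%R, T]) (Y s w ^+ 2)%:E < +oo)%E ->
  (\int[P]_w (Z t w ^+ 2)%:E <=
   32%:E * \int[P]_w \int[mu]_(s in `[0%R, T]) (Y s w ^+ 2)%:E)%E.
Proof.
move=> t0T [[adY mY] _ [adZ _] [H [aH HY HZ]]].
set V := fun w => (\int[mu]_(s in _) _)%E.
move=> Voo.
have mZ : measurable_fun setT (Z t) := filtration_measurable_fun hF t0T (adZ _ t0T).
have mD : measurable (`[0, T]%classic : set R) by [].
have V0 w : (0 <= V w)%E by apply: integral_ge0 => s _; rewrite lee_fin sqr_ge0.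
have mV : measurable_fun setT V.
  apply: (@measurable_integral_section _ _ _ `[0, T]%classic
    (fun p => (Y p.1 p.2 ^+ 2)%:E)) => //.
    by apply/measurable_EFinP; exact: measurable_funX.
  by move=> p; rewrite lee_fin sqr_ge0.
pose b := fine (\int[P]_w V w).
have bE : (\int[P]_w V w)%E = b%:E.
  by rewrite fineK// ge0_fin_numE//; exact: integral_ge0.
have b0 : 0 <= b by apply: fine_ge0; exact: integral_ge0.
rewrite bE -EFinM (_ : 32 * b = 2 * (16 * b)); last by ring.
apply: second_moment_le_in_probability => // e e0.
(* The second moment of the truncated integral will be at most
   [8 * (2 * dl + 2 * b + K * eta)]: [dl] is the distance to [Y] in energy, [eta]
   the probability that this distance is larger. The choices make the excess
   over [16 * b] at most [e], and [K] makes the probability that the truncation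
   is active at most [e / 3 + eta], by Markov's inequality. *)
pose dl := e / 64.
have dl0 : 0 < dl by rewrite divr_gt0.
pose K := 3 * (2 * dl + 2 * b) / e.
have K0 : 0 < K.
  by rewrite divr_gt0// mulr_gt0// ltr_pwDl// ?mulr_gt0// mulr_ge0.
pose eta := Num.min (e / 3) (e / (16 * K)).
have eta0 : 0 < eta by rewrite lt_min !divr_gt0// mulr_gt0.
have e30 : 0 < e / 3 by rewrite divr_gt0.
have [n [nD nI]] : exists n,
    (P [set w | (dl%:E <= \int[mu]_(s in `[0%R, T])
      ((simple_eval (H n) s w - Y s w) ^+ 2)%:E)%E] <= eta%:E)%E /\
    (P [set w | (e <= `|simple_integral W (H n) t w - Z t w|)%R] <= (e / 3)%:E)%E.
  near \oo => n; exists n; split; near: n.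
    by apply: cvg0_near_le => //; exact: HY.
  by apply: cvg0_near_le => //; exact: HZ.
set D := fun w => (\int[mu]_(s in `[0%R, T]) ((simple_eval (H n) s w - Y s w) ^+ 2)%:E)%E.
set A := [set w | (dl%:E <= _)%E] in nD.
have mdiff : measurable_fun (`[0, T] `*` [set: Omega])
    (fun p => simple_eval (H n) p.1 p.2 - Y p.1 p.2).
  by apply: measurable_funB => //; exact: simple_eval_measurable.
have mDn : measurable_fun setT D.
  apply: (@measurable_integral_section _ _ _ `[0, T]%classic
    (fun p => ((simple_eval (H n) p.1 p.2 - Y p.1 p.2) ^+ 2)%:E)) => //.
    by apply/measurable_EFinP; exact: measurable_funX.
  by move=> p; rewrite lee_fin sqr_ge0.
have mA : measurable A.
  by rewrite -[A]setTI; exact: emeasurable_fun_c_infty.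
have [ps _ _] := aH n.
pose q := simple_energy (H n) (sp_size (H n)).
have mq : measurable_fun setT q := simple_energy_measurable hF (aH n) (leqnn _).
have q0 w : 0 <= q w := simple_energy_ge0 w (aH n) (leqnn _).
(* Integrates [H ^+ 2 <= 2 * (H - Y) ^+ 2 + 2 * Y ^+ 2]. *)
have qle w : ((q w)%:E <= 2%:E * D w + 2%:E * V w)%E.
  have mYw : measurable_fun `[0, T]%classic (fun s => Y s w).
    exact: (measurable_fun_section w mD mY).
  have mHYw : measurable_fun `[0, T]%classic (fun s => simple_eval (H n) s w - Y s w).
    exact: (measurable_fun_section w mD mdiff).
  rewrite /q simple_energyE// -!ge0_integralZl//; last 4 first.
  - by apply/measurable_EFinP; exact: measurable_funX.
  - by move=> s _; rewrite lee_fin sqr_ge0.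
  - by apply/measurable_EFinP; exact: measurable_funX.
  - by move=> s _; rewrite lee_fin sqr_ge0.
  have mHY2 : measurable_fun `[0, T]%classic
      (fun s => 2%:E * ((simple_eval (H n) s w - Y s w) ^+ 2)%:E)%E.
    by apply: measurable_funeM; apply/measurable_EFinP; exact: measurable_funX.
  have mY2 : measurable_fun `[0, T]%classic (fun s => 2%:E * (Y s w ^+ 2)%:E)%E.
    by apply: measurable_funeM; apply/measurable_EFinP; exact: measurable_funX.
  rewrite -ge0_integralD//; last 2 first.
  - by move=> s _; rewrite -EFinM lee_fin mulr_ge0// sqr_ge0.
  - by move=> s _; rewrite -EFinM lee_fin mulr_ge0// sqr_ge0.
  apply: ge0_le_integral => //.
  - by move=> s _; rewrite lee_fin sqr_ge0.
  - apply/measurable_EFinP; apply: measurable_funX.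
    rewrite (_ : (fun s => _) = (fun s => (simple_eval (H n) s w - Y s w) + Y s w)).
      exact: measurable_funD.
    by apply/funext => s; rewrite subrK.
  - exact: emeasurable_funD.
  - move=> s _; rewrite -!EFinM -EFinD lee_fin.
    have := sqr_ge0 (simple_eval (H n) s w - 2 * Y s w); nra.
have mminq : measurable_fun setT (fun w => (Num.min (q w) K)%:E).
  by apply/measurable_EFinP; exact: measurable_minr.
have minq0 w : (0 <= (Num.min (q w) K)%:E)%E by rewrite lee_fin le_min q0 ltW.
have minqE : (\int[P]_w (Num.min (q w) K)%:E <= (2 * dl + 2 * b + K * eta)%:E)%E.
  have m2V : measurable_fun setT (fun w => 2%:E * V w)%E by exact: measurable_funeM.
  have mKA : measurable_fun setT (fun w => (K%:E * (\1_A w)%:E)%E).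
    by apply: measurable_funeM; exact/measurable_EFinP.
  have VA0 w : (0 <= 2%:E * V w)%E by rewrite mule_ge0.
  have KA0 w : (0 <= K%:E * (\1_A w)%:E)%E by rewrite mule_ge0// lee_fin ltW.
  apply: (@le_trans _ _ (\int[P]_w ((2 * dl)%:E + (2%:E * V w + K%:E * (\1_A w)%:E)))%E).
    apply: ge0_le_integral => //.
      by apply: emeasurable_funD => //; exact: emeasurable_funD.
    move=> w _; rewrite indicE; case: (boolP (w \in A)) => wA.
      rewrite mule1; apply: (@le_trans _ _ K%:E).
        by rewrite lee_fin ge_min lexx orbT.
      by rewrite addeA leeDr// adde_ge0// lee_fin mulr_ge0// ltW.
    rewrite mule0 adde0; apply: (@le_trans _ _ (q w)%:E).
      by rewrite lee_fin ge_min lexx.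
    apply: (le_trans (qle w)); rewrite leeD2r// EFinM lee_wpmul2l//.
    by move: wA; rewrite notin_setE/= => /negP; rewrite -ltNge => /ltW.
  rewrite ge0_integralD//; last 3 first.
  - by move=> w _; rewrite lee_fin mulr_ge0// ltW.
  - by move=> w _; rewrite adde_ge0.
  - exact: emeasurable_funD.
  rewrite ge0_integralD// integral_cst//= probability_setT mule1.
  rewrite !ge0_integralZl//; last 2 first.
  - exact/measurable_EFinP.
  - by rewrite lee_fin ltW.
  rewrite integral_indic// setIT -addrA !EFinD leeD2l//.
  by rewrite bE !EFinM leeD2l//; apply: lee_wpmul2l; rewrite ?lee_fin// ltW.
have [J [mJ J2 JE]] := simple_integral_truncated hF hW (ltW K0) t0T (aH n).
have Keta : K * eta <= e / 16.
  have -> : e / 16 = K * (e / (16 * K)) by field; rewrite gt_eqF.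
  by rewrite ler_wpM2l ?(ltW K0)// ge_min lexx orbT.
exists J; split => //.
  apply: (le_trans J2); apply: (@le_trans _ _ (8%:E * (2 * dl + 2 * b + K * eta)%:E)%E).
    exact: lee_wpmul2l.
  by rewrite -EFinM lee_fin /dl; lra.
pose B := [set w | K <= q w].
have mB : measurable B.
  by rewrite -[B]setTI; apply: measurable_fun_le.
have PB : (P B <= (2 * e / 3)%:E)%E.
  have : (K%:E * P B <= (2 * dl + 2 * b + K * eta)%:E)%E.
    apply: le_trans minqE; rewrite -[B]setIT -integral_indic// -ge0_integralZl//; last 2 first.
    - exact/measurable_EFinP.
    - by rewrite lee_fin ltW.
    apply: ge0_le_integral => //.
    - by move=> w _; rewrite mule_ge0// lee_fin ltW.
    - by apply: measurable_funeM; exact/measurable_EFinP.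
    - move=> w _; rewrite indicE; case: (boolP (w \in B)) => wB; last by rewrite mule0.
      by rewrite mule1 lee_fin min_r//; move: wB; rewrite inE.
  rewrite -lee_pdivlMl// => /le_trans; apply; rewrite -EFinM lee_fin.
  have -> : K^-1 * (2 * dl + 2 * b + K * eta) = (2 * dl + 2 * b) / K + eta.
    by field; rewrite gt_eqF.
  have -> : (2 * dl + 2 * b) / K = e / 3.
    rewrite /K; field; rewrite gt_eqF//= gt_eqF//.
    by rewrite ltr_pwDl// ?mulr_gt0// mulr_ge0.
  have : eta <= e / 3 by rewrite ge_min lexx.
  by lra.
set I0 := [set w | e <= `|simple_integral _ _ _ _ - _|] in nI.
have mI0 : measurable I0.
  rewrite -[I0]setTI; apply: measurable_fun_le => //.
  apply: measurableT_comp => //; apply: measurable_funB => //.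
  exact: (simple_integral_measurable hF hW t0T (aH n)).
apply: (@le_trans _ _ (P (I0 `|` B))).
  apply: le_measure; rewrite ?inE//.
  - rewrite -[X in measurable X]setTI; apply: measurable_fun_le => //.
    by apply: measurableT_comp => //; exact: measurable_funB.
  - exact: measurableU.
  - move=> w /= eJ; have [qK|Kq] := leP (q w) K.
      by left; rewrite /I0/= -JE.
    by right; exact: ltW.
apply: (le_trans (measureU2 _ mI0 mB)).
apply: (@le_trans _ _ ((e / 3)%:E + (2 * e / 3)%:E)%E); first exact: leeD.
by rewrite -EFinD lee_fin; lra.
Unshelve. all: by end_near. Qed.

End ito_second_moment.

(** * Gronwall's inequality *)

Section gronwall.
Context {R : realType}.
Notation mu := (@lebesgue_measure R).
Implicit Types (T C : R) (f g a : R -> R).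

Lemma within_continuous_comp (A : set R) f g :
  {within A, continuous f} -> continuous g -> {within A, continuous (g \o f)}.
Proof. by move=> cf cg s; apply: cvg_comp; [exact: cf|exact: cg]. Qed.

Lemma within_continuous_integrable T t f : t <= T ->
  {within `[0, T], continuous f} -> mu.-integrable `[0, t] (EFin \o f).
Proof.
move=> tT cf; apply: continuous_compact_integrable; first exact: segment_compact.
apply: continuous_subspaceW cf => s /=; rewrite !in_itv/= => /andP[-> st].
exact: le_trans tT.
Qed.

Lemma lebesgue_measure_itv0T T : 0 < T ->
  lebesgue_measure (`[0, T]%classic : set R) = T%:E.
Proof. by move=> T0; rewrite lebesgue_measure_itv/= lte_fin T0 oppr0 adde0. Qed.

Lemma integrable_cst0T T (k : R) : mu.-integrable `[0, T] (EFin \o (fun=> k)).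
Proof.
apply: within_continuous_integrable (lexx T) _.
by apply: continuous_subspaceT; exact: cst_continuous.
Qed.

(** Write [A] and [G] for the primitives of [a] and [g]. The hypothesis says
    [g <= C * G + a], so the derivative of [A t - expR (- C * t) * G t] is at
    least [(1 - expR (- C * t)) * a t >= 0]; this function starts at [0] and is
    hence nonnegative at [T]. *)
Lemma gronwall_integral T C g a : 0 < T -> 0 <= C ->
  {within `[0, T], continuous g} -> {within `[0, T], continuous a} ->
  (forall t, 0 <= t <= T -> 0 <= a t) ->
  (forall t, 0 <= t <= T -> g t <= C * (\int[mu]_(s in `[0, t]) g s) + a t) ->
  \int[mu]_(s in `[0, T]) g s <= expR (C * T) * \int[mu]_(s in `[0, T]) a s.
Proof.
move=> T0 C0 cg ca a0 hg.
pose G t := \int[mu]_(s in `[0, t]) g s.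
pose A t := \int[mu]_(s in `[0, t]) a s.
have ig := within_continuous_integrable (lexx T) cg.
have ia := within_continuous_integrable (lexx T) ca.
have dG t : t \in `]0, T[ -> is_derive t 1 G (g t).
  move=> t0T; have /andP[t0 tT] : 0 < t < T by rewrite in_itv/= in t0T.
  have ct := within_continuous_continuous T0 cg t0T.
  have [dG Gt] := continuous_FTC1_closed tT ig t0 ct.
  by rewrite derive1E in Gt; exact: (DeriveDef dG Gt).
have dA t : t \in `]0, T[ -> is_derive t 1 A (a t).
  move=> t0T; have /andP[t0 tT] : 0 < t < T by rewrite in_itv/= in t0T.
  have ct := within_continuous_continuous T0 ca t0T.
  have [dA At] := continuous_FTC1_closed tT ia t0 ct.
  by rewrite derive1E in At; exact: (DeriveDef dA At).
have cG : {within `[0, T], continuous G}.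
  exact: parameterized_integral_continuous (ltW T0) ig.
have cA : {within `[0, T], continuous A}.
  exact: parameterized_integral_continuous (ltW T0) ia.
pose E t := expR (- C * t).
have dE (t : R) : is_derive t 1 E (- C * E t).
  have dm : is_derive t (1 : R) ((- C) *: (id : R -> R)) ((- C) *: (1 : R)).
    exact: is_deriveZ.
  have := @is_derive1_comp _ expR ((- C) *: (id : R -> R)) t _ _ (is_derive_expR _) dm.
  by rewrite /GRing.scale/= mulr1 mulrC.
have cE : continuous E.
  by move=> t; apply/differentiable_continuous/derivable1_diffP; have [] := dE t.
pose Phi := (A - E * G)%R.
have dPhi t : t \in `]0, T[ ->
    is_derive t 1 Phi (a t - (E t * g t + G t * (- C * E t))).
  move=> t0T; have dGt := dG t t0T; have dAt := dA t t0T; have dEt := dE t.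
  exact: (is_deriveB dAt (is_deriveM dEt dGt)).
have cPhi : {within `[0, T], continuous Phi}.
  move=> t; apply: cvgB; first exact: cA.
  apply: cvgM; last exact: cG.
  by apply: continuous_subspaceT.
have T00 : Phi 0 <= Phi T.
  apply: (@ger0_derive1_le_cc _ Phi 0 T _ _ cPhi 0 T); rewrite ?in_itv/= ?lexx ?ltW//.
    by move=> t t0T; have [] := dPhi t t0T.
  move=> t t0T; have [_ Phi't] := dPhi t t0T.
  rewrite derive1E Phi't; have /andP[t0 tT] : 0 < t < T by rewrite in_itv/= in t0T.
  have t0T' : 0 <= t <= T by rewrite !ltW.
  have := hg t t0T'; rewrite -/(G t) => hgt.
  have E0 : 0 <= E t by exact: expR_ge0.
  have E1 : E t <= 1 by rewrite /E -[leRHS]expR0 ler_expR mulNr oppr_le0 mulr_ge0// ltW.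
  have := a0 t t0T'; nra.
have PhiO : Phi 0 = 0.
  by rewrite /Phi /= !fctE /A /G set_itv1 !Rintegral_set1 mulr0 subr0.
rewrite PhiO in T00.
have : E T * G T <= A T by rewrite -subr_ge0.
by rewrite /E mulNr expRN mulrC ler_pdivrMr ?expR_gt0// mulrC.
Qed.

End gronwall.

(** * Perturbed differential equations *)

Section pathwise.
Context {R : realType}.
Notation mu := (@lebesgue_measure R).
Implicit Types (T C : R) (S x X z a : R -> R).

Lemma lipschitz_continuous C S : (forall u v, `|S u - S v| <= C * `|u - v|) ->
  continuous S.
Proof.
move=> SC x; apply/cvgrPdist_le => /= e e0.
have C1 : 0 < `|C| + 1 by rewrite ltr_wpDl.
near=> y; apply: (le_trans (SC x y)).
apply: (@le_trans _ _ ((`|C| + 1) * `|x - y|)).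
  by rewrite ler_wpM2r// (le_trans (ler_norm C))// lerDl.
rewrite -ler_pdivlMl// mulrC; near: y.
by apply: cvgr_dist_le; [exact: cvg_id|rewrite divr_gt0].
Unshelve. all: by end_near. Qed.

Lemma within_continuous_normB (A : set R) (f g : R -> R) :
  {within A, continuous f} -> {within A, continuous g} ->
  {within A, continuous (fun t => `|f t - g t|)}.
Proof.
move=> cf cg; apply: (@within_continuous_comp _ _ (f - g) (fun u => `|u|)).
  exact: within_continuousB.
exact: norm_continuous.
Qed.

(** The equation holds in the interior only; continuity up to the endpoints
    suffices for the fundamental theorem of calculus. *)
Lemma ode_solution_integral T (x0 : R) S x (t : R) : 0 < T -> continuous S ->
  ode_solution T x0 S x -> 0 <= t <= T ->
  x t = x0 + \int[mu]_(s in `[0, t]) S (x s).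
Proof.
move=> T0 cS [xx0 cx dx] /andP[]; rewrite le_eqVlt => /predU1P[<- _|t0 tT].
  by rewrite set_itv1 Rintegral_set1 addr0.
have sub : `[0, t]%classic `<=` `[0, T]%classic.
  by move=> s /=; rewrite !in_itv/= => /andP[-> st]; exact: le_trans tT.
have cxt := continuous_subspaceW sub cx.
have subo s : s \in `]0, t[ -> s \in `]0, T[.
  by rewrite !in_itv/= => /andP[-> st]; exact: lt_le_trans tT.
rewrite /Rintegral (@continuous_FTC2 _ (S \o x) x 0 t)//=.
- by rewrite xx0 subrKC.
- exact: within_continuous_comp.
- have [_ x0t xtt] := (continuous_within_itvP x t0).1 cxt.
  split => // s /subo st; by have [] := dx s st.
- by move=> s /subo st; have [_ xs] := dx s st; rewrite derive1E.
Qed.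

(** Gronwall's inequality bounds the integral of [`|X - x|]; inserting this in
    the Lipschitz estimate once more gives the bound at each time. *)
Lemma perturbed_ode_dist_le T C S x X z (x0 : R) : 0 < T -> 0 <= C ->
  (forall u v, `|S u - S v| <= C * `|u - v|) ->
  {within `[0, T], continuous x} -> {within `[0, T], continuous X} ->
  {within `[0, T], continuous z} ->
  (forall t, 0 <= t <= T -> x t = x0 + \int[mu]_(s in `[0, t]) S (x s)) ->
  (forall t, 0 <= t <= T -> X t = x0 + (\int[mu]_(s in `[0, t]) S (X s)) + z t) ->
  forall t, 0 <= t <= T -> `|X t - x t| <=
    C * expR (C * T) * (\int[mu]_(s in `[0, T]) `|z s|) + `|z t|.
Proof.
move=> T0 C0 SC cx cX cz xE XE.
have cS := lipschitz_continuous SC.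
pose g t := `|X t - x t|.
have cg : {within `[0, T], continuous g} by exact: within_continuous_normB.
have cza : {within `[0, T], continuous (fun t => `|z t|)}.
  by apply: (within_continuous_comp cz); exact: norm_continuous.
have hg t : 0 <= t <= T -> g t <= C * (\int[mu]_(s in `[0, t]) g s) + `|z t|.
  move=> t0T; have /andP[_ tT] := t0T.
  have iSX := within_continuous_integrable tT (within_continuous_comp cX cS).
  have iSx := within_continuous_integrable tT (within_continuous_comp cx cS).
  have ig := within_continuous_integrable tT cg.
  have cd : {within `[0, T], continuous (fun s => S (X s) - S (x s))}.
    exact: within_continuousB (within_continuous_comp cX cS) (within_continuous_comp cx cS).
  rewrite /g XE// xE//.
  rewrite (_ : _ - _ = ((\int[mu]_(s in `[0, t]) S (X s)) -
    (\int[mu]_(s in `[0, t]) S (x s))) + z t); last by ring.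
  apply: (le_trans (ler_normD _ _)); rewrite lerD2r -RintegralB//.
  apply: (@le_trans _ _ (\int[mu]_(s in `[0, t]) `|S (X s) - S (x s)|)).
    by apply: le_normr_Rintegral => //; exact: within_continuous_integrable tT cd.
  rewrite -RintegralZl//; apply: le_Rintegral => //.
  - apply: within_continuous_integrable tT _.
    by apply: (within_continuous_comp cd); exact: norm_continuous.
  - exact: (integrableZl _ C ig).
have zge0 t : 0 <= t <= T -> 0 <= `|z t| by [].
have Ig := gronwall_integral T0 C0 cg cza zge0 hg.
move=> t t0T; apply: (le_trans (hg t t0T)); rewrite lerD2r -mulrA ler_wpM2l//.
apply: le_trans Ig; have /andP[_ tT] := t0T.
have ig := within_continuous_integrable (lexx T) cg.
have igt := within_continuous_integrable tT cg.
rewrite -lee_fin /Rintegral !fineK//; [|exact: integrable_fin_num..].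
apply: ge0_subset_integral => //.
- by case/integrableP : ig.
- by move=> s _; rewrite lee_fin normr_ge0.
- by move=> s /=; rewrite !in_itv/= => /andP[-> st]; exact: le_trans tT.
Qed.

(** The Cauchy-Schwarz inequality against the constant [1]: the integral of the
    square of the deviation of [a] from its mean is nonnegative. *)
Lemma Rintegral_sqr_le T a : 0 < T -> {within `[0, T], continuous a} ->
  (\int[mu]_(s in `[0, T]) a s) ^+ 2 <= T * \int[mu]_(s in `[0, T]) a s ^+ 2.
Proof.
move=> T0 ca; set I := \int[mu]_(s in _) _.
have ia := within_continuous_integrable (lexx T) ca.
have ia2 : mu.-integrable `[0, T] (EFin \o (fun s => a s ^+ 2)).
  apply: within_continuous_integrable (lexx T) _.
  apply: (@within_continuous_comp _ _ a (fun u => u ^+ 2)) => //.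
  exact: exprn_continuous.
have i0 : 0 <= \int[mu]_(s in `[0, T]) (a s - I / T) ^+ 2.
  by apply: Rintegral_ge0 => s _; exact: sqr_ge0.
have icst := integrable_cst0T T.
pose m := I / T.
have ima : mu.-integrable `[0, T] (EFin \o (fun s => - (2 * m) * a s)).
  apply: within_continuous_integrable (lexx T) _.
  apply: (@within_continuous_comp _ _ a (fun u => - (2 * m) * u)) => //.
  exact: mulrl_continuous.
have ima2 : mu.-integrable `[0, T] (EFin \o (fun s => a s ^+ 2 + - (2 * m) * a s)).
  apply: within_continuous_integrable (lexx T) _.
  apply: (@within_continuous_comp _ _ a (fun u => u ^+ 2 + - (2 * m) * u)) => //.
  by move=> u; apply: cvgD; [exact: exprn_continuous|exact: mulrl_continuous].
have lT := lebesgue_measure_itv0T T0.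
have E : \int[mu]_(s in `[0, T]) (a s - m) ^+ 2 =
    (\int[mu]_(s in `[0, T]) a s ^+ 2) - 2 * m * I + m ^+ 2 * T.
  transitivity (\int[mu]_(s in `[0, T]) (a s ^+ 2 + - (2 * m) * a s + m ^+ 2)).
    by apply: eq_Rintegral => s _; ring.
  rewrite RintegralD// RintegralD// RintegralZl// Rintegral_cst//= lT/=.
  by rewrite mulNr.
have := i0; rewrite -/m E (_ : _ + _ = (\int[mu]_(s in `[0, T]) a s ^+ 2) - I ^+ 2 / T); last first.
  by rewrite /m; field; rewrite gt_eqF.
by rewrite subr_ge0 ler_pdivrMr// mulrC.
Qed.

End pathwise.

Section diffusion_energy.
Context {R : realType}.
Notation mu := (@lebesgue_measure R).

(** By the Lipschitz property, [sigma (X s) ^+ 2] is at most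
    [2 * sigma (x s) ^+ 2 + 2 * C ^+ 2 * (X s - x s) ^+ 2], and the distance of
    the two paths is controlled by the perturbation [z]. For the diffusion, [z]
    is [eps] times its noise, so the last term carries the factor [eps ^+ 2]. *)
Lemma perturbed_diffusion_energy_le (T C : R) (S sigma x X z : R -> R) (x0 : R) :
  0 < T -> 0 <= C ->
  (forall u v, `|S u - S v| <= C * `|u - v|) ->
  (forall u v, `|sigma u - sigma v| <= C * `|u - v|) ->
  {within `[0, T], continuous x} -> {within `[0, T], continuous X} ->
  {within `[0, T], continuous z} ->
  (forall t, 0 <= t <= T -> x t = x0 + \int[mu]_(s in `[0, t]) S (x s)) ->
  (forall t, 0 <= t <= T -> X t = x0 + (\int[mu]_(s in `[0, t]) S (X s)) + z t) ->
  \int[mu]_(s in `[0, T]) sigma (X s) ^+ 2 <=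
    2 * (\int[mu]_(s in `[0, T]) sigma (x s) ^+ 2) +
    4 * C ^+ 2 * ((C * expR (C * T) * T) ^+ 2 + 1) *
      (\int[mu]_(s in `[0, T]) z s ^+ 2).
Proof.
move=> T0 C0 SC sC cx cX cz xE XE.
have dist := perturbed_ode_dist_le T0 C0 SC cx cX cz xE XE.
set K := C * expR (C * T) in dist *.
set J := \int[mu]_(s in `[0, T]) z s ^+ 2.
set I := \int[mu]_(s in `[0, T]) `|z s| in dist.
have cza : {within `[0, T], continuous (fun t => `|z t|)}.
  by apply: (within_continuous_comp cz); exact: norm_continuous.
have IJ : I ^+ 2 <= T * J.
  apply: le_trans (Rintegral_sqr_le T0 cza) _.
  by under eq_Rintegral do rewrite real_normK ?num_real//.
have csigma := lipschitz_continuous sC.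
have sqr_cont (f : R -> R) : {within `[0, T], continuous f} ->
    {within `[0, T], continuous (fun s => f s ^+ 2)}.
  by move=> cf; apply: (@within_continuous_comp _ _ f (fun u => u ^+ 2)) => //; exact: exprn_continuous.
have isx : mu.-integrable `[0, T] (EFin \o (fun s => sigma (x s) ^+ 2)).
  by apply: within_continuous_integrable (lexx T) _; apply: sqr_cont; exact: within_continuous_comp.
have isX : mu.-integrable `[0, T] (EFin \o (fun s => sigma (X s) ^+ 2)).
  by apply: within_continuous_integrable (lexx T) _; apply: sqr_cont; exact: within_continuous_comp.
have iz : mu.-integrable `[0, T] (EFin \o (fun s => z s ^+ 2)).
  by apply: within_continuous_integrable (lexx T) _; exact: sqr_cont.
have icst := integrable_cst0T T.
pose k := 4 * C ^+ 2 * (K ^+ 2 * (T * J)).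
have i1 : mu.-integrable `[0, T] (EFin \o (fun s => 2 * sigma (x s) ^+ 2)).
  exact: (integrableZl _ 2 isx).
have i2 : mu.-integrable `[0, T] (EFin \o (fun s => 4 * C ^+ 2 * z s ^+ 2)).
  exact: (integrableZl _ (4 * C ^+ 2) iz).
have i3 : mu.-integrable `[0, T] (EFin \o (fun s => 2 * sigma (x s) ^+ 2 + k)).
  exact: (integrableD _ i1 (icst k)).
have lT := lebesgue_measure_itv0T T0.
apply: (@le_trans _ _ (\int[mu]_(s in `[0, T])
    (2 * sigma (x s) ^+ 2 + k + 4 * C ^+ 2 * z s ^+ 2))).
  apply: le_Rintegral => //; first exact: (integrableD _ i3 i2).
  move=> s /=; rewrite in_itv/= => s0T.
  have := dist s s0T; have := sC (X s) (x s).
  set p := `|sigma _ - _|; set q := `|X s - x s|; set r := `|z s| => pq qr.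
  have p0 : 0 <= p by exact: normr_ge0.
  have q0 : 0 <= q by exact: normr_ge0.
  have p2 : (sigma (X s) - sigma (x s)) ^+ 2 = p ^+ 2 by rewrite /p real_normK ?num_real.
  have z2 : z s ^+ 2 = r ^+ 2 by rewrite /r real_normK ?num_real.
  have pq2 : p ^+ 2 <= C ^+ 2 * q ^+ 2 by rewrite -exprMn lerXn2r// ?nnegrE ?mulr_ge0.
  have qr2 : q ^+ 2 <= 2 * (K ^+ 2 * (T * J)) + 2 * r ^+ 2.
    apply: (@le_trans _ _ ((K * I + r) ^+ 2)).
      by rewrite lerXn2r// nnegrE// (le_trans q0).
    apply: (@le_trans _ _ (2 * (K * I) ^+ 2 + 2 * r ^+ 2)).
      by have := sqr_ge0 (K * I - r); nra.
    by rewrite lerD2r ler_wpM2l// exprMn ler_wpM2l// sqr_ge0.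
  have C2 : C ^+ 2 * q ^+ 2 <= C ^+ 2 * (2 * (K ^+ 2 * (T * J)) + 2 * r ^+ 2).
    by rewrite ler_wpM2l// sqr_ge0.
  rewrite /k z2; have := sqr_ge0 (sigma (X s) - 2 * sigma (x s)).
  rewrite -p2 in pq2; nra.
rewrite RintegralD// RintegralD// !RintegralZl// Rintegral_cst//= lT/= -/J /k.
by rewrite le_eqVlt; apply/orP; left; apply/eqP; ring.
Qed.

End diffusion_energy.

(** * Joint measurability of continuous processes *)

Section joint_measurability.
Context {R : realType} {d : measure_display} {Omega : measurableType d}.
Implicit Type Z : R -> Omega -> R.

(** By continuity, [Z] is the pointwise limit of its values at the time rounded
    down to a multiple of [n.+1%:R^-1], and those are measurable on each of
    countably many strips of constant rounded time. *)
Lemma measurable_continuous_paths (T : R) Z :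
  (forall t, 0 <= t <= T -> measurable_fun setT (Z t)) ->
  (forall w, {within `[0, T], continuous (fun t => Z t w)}) ->
  measurable_fun (`[0, T]%classic `*` [set: Omega]) (fun p => Z p.1 p.2).
Proof.
move=> mZ cZ; pose D := `[0, T]%classic : set R.
pose rho (n : nat) (s : R) : R := (Num.truncn (s * n.+1%:R))%:R / n.+1%:R.
have n0 (n : nat) : 0 < n.+1%:R :> R by rewrite ltr0Sn.
have rho_itv n s : 0 <= s -> rho n s <= s < rho n s + n.+1%:R^-1.
  move=> s0; have /truncn_itv/andP[h1 h2] : 0 <= s * n.+1%:R by rewrite mulr_ge0.
  rewrite /rho ler_pdivrMr// h1/= -[X in _ + X]mul1r -mulrDl ltr_pdivlMr//.
  by rewrite natr1.
have rho0 n s : 0 <= rho n s by rewrite divr_ge0.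
apply: (@measurable_fun_cvg _ _ _ _ (fun n p => Z (rho n p.1) p.2)) => [n|[s w] [/= Ds _]].
- pose E k := (D `&` `[k%:R / n.+1%:R, k.+1%:R / n.+1%:R[%classic) `*` [set: Omega].
  have mE k : measurable (E k) by apply: measurableX => //; apply: measurableI; exact: measurable_itv.
  have DE : D `*` [set: Omega] = \bigcup_k E k.
    apply/seteqP; split=> [[s w] [/= Ds _]|[s w] [k _ [[]]]//].
    have s0 : 0 <= s by move: Ds; rewrite /D/= in_itv/= => /andP[].
    exists (Num.truncn (s * n.+1%:R)) => //; split => //; split => //=.
    rewrite in_itv/=; have /andP[h1 h2] := rho_itv n s s0.
    by rewrite h1/= (lt_le_trans h2)// /rho -[in leRHS]natr1 mulrDl mul1r.
  rewrite DE; apply/measurable_fun_bigcup => // k.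
  have [kT|kT] := leP (k%:R / n.+1%:R) T; last first.
    rewrite (_ : E k = set0); first exact: measurable_fun_set0.
    apply/seteqP; split => // -[s w] [[]]; rewrite /D/= !in_itv/=.
    by move=> /andP[_ sT] /andP[ks _]; have := lt_le_trans kT (le_trans ks sT); rewrite ltxx.
  apply: (eq_measurable_fun (fun p => Z (k%:R / n.+1%:R) p.2)).
    move=> [s w]; rewrite inE => -[[/= Ds]]; rewrite in_itv/= => /andP[ks sk] _.
    congr (Z (_ / _) _); congr (_%:R); apply/esym/truncn_def.
    by rewrite -ler_pdivrMr// ks -ltr_pdivlMr.
  apply: measurable_funTS; apply: measurableT_comp => //.
  by apply: mZ; rewrite kT divr_ge0.
- have /subspace_continuousP/(_ s Ds) := cZ w.
  move=> /cvgrPdist_le cZs; apply/cvgrPdist_le => e e0.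
  have /= := cZs e e0; rewrite near_withinE => /nbhs_ballP[r /= r0 hr].
  have s0 : 0 <= s by move: Ds; rewrite /D/= in_itv/= => /andP[].
  have sT : s <= T by move: Ds; rewrite /D/= in_itv/= => /andP[].
  near=> n; have /andP[h1 h2] := rho_itv n s s0.
  apply: hr.
    rewrite /ball/= ger0_norm ?subr_ge0// ltrBlDl (lt_le_trans h2)// lerD2l.
    rewrite ltW//; near: n; exact: near_infty_natSinv_lt (PosNum r0).
  by rewrite /= in_itv/= rho0 (le_trans h1).
Unshelve. all: by end_near. Qed.

End joint_measurability.

(** * Uniform second moments of the noise *)

Section noise_moment.
Context {R : realType} {d : measure_display} {Omega : measurableType d}.
Variables (P : probability Omega R) (T x0 : R) (F : R -> set_system Omega).
Variable W : R -> Omega -> R.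
Hypothesis hF : is_filtration T F.
Hypothesis hW : is_wiener P T F W.
Notation mu := (@lebesgue_measure R).

(** [sigma] grows at most linearly, so the second moment bound on the solution
    passes to [sigma (X s)]. The value of the bound depends on [eps] in an
    unknown way: only its finiteness is of use, for the absorption argument
    below. *)
Lemma sde_diffusion_energy_fin C (sigma : R -> R) (X : R -> Omega -> R) : 0 < T ->
  (forall u v, `|sigma u - sigma v| <= C * `|u - v|) ->
  adapted T F X ->
  measurable_fun (`[0, T] `*` [set: Omega]) (fun p => sigma (X p.1 p.2)) ->
  (ereal_sup [set 'E_P[(fun w => `|X s w| ^+ 2)%R] | s in `[0%R, T]] < +oo)%E ->
  (\int[P]_w \int[mu]_(s in `[0%R, T]) (sigma (X s w) ^+ 2)%:E < +oo)%E.
Proof.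
move=> T0 sC adX msX; set M := ereal_sup _ => Moo.
have EXM s : 0 <= s <= T -> (\int[P]_w (X s w ^+ 2)%:E <= M)%E.
  move=> s0T; apply: ereal_sup_ubound; exists s => //.
  rewrite unlock; apply: eq_integral => w _.
  by rewrite /= real_normK ?num_real.
have M0 : (0 <= M)%E.
  apply: le_trans (EXM 0 _); last by rewrite lexx ltW.
  by apply: integral_ge0 => w _; rewrite lee_fin sqr_ge0.
have mX s : 0 <= s <= T -> measurable_fun setT (X s).
  by move=> s0T; exact: (filtration_measurable_fun hF s0T (adX _ s0T)).
have msX2 : measurable_fun (`[0, T] `*` [set: Omega])
    (fun p => (sigma (X p.1 p.2) ^+ 2)%:E).
  by apply/measurable_EFinP; exact: measurable_funX.
rewrite (@tonelli_section _ _ _ P `[0, T]%classic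
  (fun p => (sigma (X p.1 p.2) ^+ 2)%:E))//; last first.
  by move=> p; rewrite lee_fin sqr_ge0.
have lT := lebesgue_measure_itv0T T0.
have [m m0 ME] : exists2 m, 0 <= m & M = m%:E.
  by exists (fine M); rewrite ?fine_ge0// fineK// ge0_fin_numE.
pose k := 2 * sigma 0 ^+ 2 + 2 * C ^+ 2 * m.
apply: (@le_lt_trans _ _ (\int[mu]_(s in `[0%R, T]) k%:E)%E); last first.
  by rewrite integral_cst//= lT -EFinM ltry.
have C2 : 0 <= 2 * C ^+ 2 by rewrite mulr_ge0// sqr_ge0.
have s2 : 0 <= 2 * sigma 0 ^+ 2 by rewrite mulr_ge0// sqr_ge0.
apply: ge0_le_integral => //.
- by move=> s _; apply: integral_ge0 => w _; rewrite lee_fin sqr_ge0.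
- apply: (@measurable_integral_time_section _ _ _ P `[0, T]%classic
    (fun p => (sigma (X p.1 p.2) ^+ 2)%:E)) => //.
  by move=> p; rewrite lee_fin sqr_ge0.
- move=> s /=; rewrite in_itv/= => s0T.
  apply: (@le_trans _ _ (\int[P]_w ((2 * sigma 0 ^+ 2)%:E + (2 * C ^+ 2)%:E * (X s w ^+ 2)%:E))%E).
    apply: ge0_le_integral => //.
    + by move=> w _; rewrite lee_fin sqr_ge0.
    + apply/measurable_EFinP; apply: measurable_funX.
      apply: (measurableT_comp _ (mX s s0T)).
      by apply: continuous_measurable_fun; exact: lipschitz_continuous sC.
    + apply: emeasurable_funD => //; apply: measurable_funeM.
      by apply/measurable_EFinP; apply: measurable_funX; exact: mX.
    + move=> w _; rewrite -EFinM -EFinD lee_fin.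
      have := sC (X s w) 0; rewrite subr0.
      set p := `|sigma _ - _|; set q := `|X s w| => pq.
      have p0 : 0 <= p by exact: normr_ge0.
      have p2 : (sigma (X s w) - sigma 0) ^+ 2 = p ^+ 2 by rewrite /p real_normK ?num_real.
      have q2 : X s w ^+ 2 = q ^+ 2 by rewrite /q real_normK ?num_real.
      have pq2 : p ^+ 2 <= C ^+ 2 * q ^+ 2.
        by rewrite -exprMn lerXn2r// ?nnegrE// (le_trans p0).
      rewrite q2; have := sqr_ge0 (sigma (X s w) - 2 * sigma 0).
      rewrite -p2 in pq2; nra.
  have mX2 : measurable_fun setT (fun w => (X s w ^+ 2)%:E).
    by apply/measurable_EFinP; apply: measurable_funX; exact: mX.
  rewrite ge0_integralD//; last 2 first.
  + by move=> w _; rewrite mule_ge0// lee_fin sqr_ge0.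
  + exact: measurable_funeM.
  rewrite integral_cst//= probability_setT mule1 ge0_integralZl//; last first.
    by move=> w _; rewrite lee_fin sqr_ge0.
  rewrite /k EFinD leeD2l// [leRHS]EFinM -ME.
  by apply: lee_wpmul2l; [rewrite lee_fin|exact: EXM].
Qed.

(** Let [b] be the expected energy of [sigma (X s)], and [s2] the energy of
    [sigma] along the limit path. The Ito bound gives [32 * b] for the second
    moment of [Z t]. Conversely, the pathwise energy estimate gives
    [b <= 2 * s2 + c * eps ^+ 2 * (32 * b * T)]. Once [eps] is small the last term
    is at most [b / 2], and since [b] is finite it can be absorbed in the left
    side: [b <= 4 * s2], uniformly in [eps]. *)
Lemma sde_noise_second_moment_le (S sigma xS : R -> R) : 0 < T ->
  cond_A1 S sigma -> cond_A2 P T F W x0 S sigma -> ode_solution T x0 S xS ->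
  exists2 kappa, 0 <= kappa & exists2 eps0, 0 < eps0 &
  forall eps, 0 < eps -> eps < eps0 ->
  forall X, sde_solution P T F W x0 S sigma eps X ->
  exists Z : R -> Omega -> R,
    [/\ forall t, 0 <= t <= T -> measurable_fun setT (Z t),
        continuous_paths T Z,
        {ae P, forall w, forall t, t \in `[0, T] ->
           X t w = x0 + (\int[mu]_(s in `[0, t]) S (X s w)) + eps * Z t w} &
        forall t, 0 <= t <= T -> (\int[P]_w (Z t w ^+ 2)%:E <= kappa%:E)%E].
Proof.
move=> T0 [C C0 lipSs] A2 xSode.
have SC u v : `|S u - S v| <= C * `|u - v| by have [] := lipSs u v.
have sC u v : `|sigma u - sigma v| <= C * `|u - v| by have [] := lipSs u v.
have cS := lipschitz_continuous SC.
have csigma := lipschitz_continuous sC.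
have [_ cx _] := xSode.
have xE t : 0 <= t <= T -> xS t = x0 + \int[mu]_(s in `[0, t]) S (xS s).
  exact: ode_solution_integral.
pose s2 := \int[mu]_(s in `[0, T]) sigma (xS s) ^+ 2.
pose c := 4 * C ^+ 2 * ((C * expR (C * T) * T) ^+ 2 + 1).
have c0 : 0 <= c.
  by rewrite /c mulr_ge0 ?addr_ge0 ?sqr_ge0// mulr_ge0// sqr_ge0.
have cT0 : 0 <= 64 * c * T by rewrite mulr_ge0 ?(ltW T0)// mulr_ge0.
have s20 : 0 <= s2 by apply: Rintegral_ge0 => s _; exact: sqr_ge0.
exists (128 * s2); first by rewrite mulr_ge0.
exists (64 * c * T + 1)^-1; first by rewrite invr_gt0 ltr_wpDl.
move=> eps eps_gt0 eps_small X hX.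
have EX := A2 eps eps_gt0 X hX.
have [adX cX _ [Z hZ XE]] := hX.
exists Z; have [[adY mY] _ [adZ cZ] _] := hZ.
have mZ t : 0 <= t <= T -> measurable_fun setT (Z t).
  by move=> t0T; exact: (filtration_measurable_fun hF t0T (adZ _ t0T)).
have jmZ := measurable_continuous_paths mZ cZ.
have Boo := sde_diffusion_energy_fin T0 sC adX mY EX.
have ito t t0T := ito_second_moment_le hF hW (t := t) t0T hZ Boo.
set B := (\int[P]_w _)%E in Boo ito.
have B0 : (0 <= B)%E.
  apply: integral_ge0 => w _; apply: integral_ge0 => s _.
  by rewrite lee_fin sqr_ge0.
have [b b0 BE] : exists2 b, 0 <= b & B = b%:E.
  by exists (fine B); rewrite ?fine_ge0// fineK// ge0_fin_numE.
have sq_within (f : R -> R) : {within `[0, T], continuous f} ->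
    mu.-integrable `[0, T] (EFin \o (fun s => f s ^+ 2)).
  move=> cf; apply: within_continuous_integrable (lexx T) _.
  by apply: (@within_continuous_comp _ _ f (fun u => u ^+ 2)) => //; exact: exprn_continuous.
have RE (f : R -> R) : {within `[0, T], continuous f} ->
    (\int[mu]_(s in `[0%R, T]) (f s ^+ 2)%:E)%E =
    (\int[mu]_(s in `[0, T]) f s ^+ 2)%:E.
  by move=> cf; rewrite /Rintegral fineK//; apply: integrable_fin_num => //; exact: sq_within.
have lT := lebesgue_measure_itv0T T0.
have mZ2 : measurable_fun (`[0, T] `*` [set: Omega]) (fun p => (Z p.1 p.2 ^+ 2)%:E).
  by apply/measurable_EFinP; exact: measurable_funX.
have Z20 (p : R * Omega) : (0 <= (Z p.1 p.2 ^+ 2)%:E)%E by rewrite lee_fin sqr_ge0.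
have mIZ : measurable_fun setT (fun w => \int[mu]_(s in `[0%R, T]) (Z s w ^+ 2)%:E)%E.
  exact: (@measurable_integral_section _ _ _ `[0, T]%classic
    (fun p => (Z p.1 p.2 ^+ 2)%:E)).
have EZ : (\int[P]_w \int[mu]_(s in `[0%R, T]) (Z s w ^+ 2)%:E <= (32 * b * T)%:E)%E.
  rewrite (@tonelli_section _ _ _ P `[0, T]%classic
    (fun p => (Z p.1 p.2 ^+ 2)%:E))//.
  apply: (@le_trans _ _ (\int[mu]_(s in `[0%R, T]) (32 * b)%:E)%E).
    apply: ge0_le_integral => //.
    - by move=> s _; apply: integral_ge0 => w _.
    - exact: (@measurable_integral_time_section _ _ _ P `[0, T]%classic
        (fun p => (Z p.1 p.2 ^+ 2)%:E)).
    - by move=> s /= s0T; rewrite EFinM -BE ito.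
  by rewrite integral_cst//= lT -EFinM.
have Ble : (B <= (2 * s2)%:E + (c * eps ^+ 2)%:E * (32 * b * T)%:E)%E.
  have ce0 : 0 <= c * eps ^+ 2 by rewrite mulr_ge0// sqr_ge0.
  have s220 : 0 <= 2 * s2 by rewrite mulr_ge0.
  have IZ0 w : (0 <= \int[mu]_(s in `[0%R, T]) (Z s w ^+ 2)%:E)%E.
    by apply: integral_ge0 => s _; rewrite lee_fin sqr_ge0.
  apply: (@le_trans _ _ (\int[P]_w ((2 * s2)%:E + (c * eps ^+ 2)%:E *
      \int[mu]_(s in `[0%R, T]) (Z s w ^+ 2)%:E))%E).
    apply: ae_ge0_le_integral => //.
    - by move=> w _; apply: integral_ge0 => s _; rewrite lee_fin sqr_ge0.
    - apply: (@measurable_integral_section _ _ _ `[0, T]%classic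
        (fun p => (sigma (X p.1 p.2) ^+ 2)%:E)) => //.
        by apply/measurable_EFinP; exact: measurable_funX.
      by move=> p; rewrite lee_fin sqr_ge0.
    - by move=> w _; rewrite adde_ge0// mule_ge0.
    - by apply: emeasurable_funD => //; exact: measurable_funeM.
    - apply: filterS XE => w XEw _.
      have cez : {within `[0, T], continuous (fun t => eps * Z t w)}.
        apply: (@within_continuous_comp _ _ (Z^~ w) (fun u => eps * u)) => //.
        exact: mulrl_continuous.
      have := perturbed_diffusion_energy_le T0 (ltW C0) SC sC cx (cX w) cez xE XEw.
      rewrite -/s2 -/c.
      have -> : \int[mu]_(s in `[0, T]) (eps * Z s w) ^+ 2 =
          eps ^+ 2 * \int[mu]_(s in `[0, T]) Z s w ^+ 2.
        under eq_Rintegral do rewrite exprMn.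
        by rewrite RintegralZl//; exact: sq_within.
      rewrite (RE _ (cZ w)) (RE (sigma \o X^~ w)) ?mulrA; last first.
        by apply: within_continuous_comp; first exact: cX.
      by move=> h; rewrite -EFinM -EFinD lee_fin.
  rewrite ge0_integralD//; last 2 first.
  - by move=> w _; rewrite mule_ge0.
  - exact: measurable_funeM.
  rewrite integral_cst//= probability_setT mule1 ge0_integralZl//.
  by rewrite leeD2l// lee_wpmul2l.
move: Ble; rewrite BE -EFinM -EFinD lee_fin => Ble.
have eps1 : eps <= 1.
  by rewrite ltW// (lt_le_trans eps_small)// invf_le1 ?ltr_wpDl// lerDr.
have epsc : 64 * c * T * eps <= 1.
  have : (64 * c * T + 1) * eps <= 1.
    by rewrite mulrC -ler_pdivlMr ?ltr_wpDl// mul1r ltW.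
  by apply: le_trans; rewrite ler_wpM2r ?ltW// ltrDl.
have epsc2 : 64 * c * T * eps ^+ 2 <= 1.
  apply: le_trans epsc; rewrite ler_wpM2l// expr2 ler_piMr// ltW//.
have bs2 : b <= 4 * s2.
  have : 64 * c * T * eps ^+ 2 * b <= 1 * b by rewrite ler_wpM2r.
  lra.
split => // t t0T; apply: (le_trans (ito t t0T)).
by rewrite BE -EFinM lee_fin; lra.
Qed.

End noise_moment.

(** * Riemann sums *)

Section riemann_sums.
Context {R : realType}.
Notation mu := (@lebesgue_measure R).

Lemma Rintegral_increment_le (T a b c B : R) (f : R -> R) :
  {within `[0, T], continuous f} -> 0 <= a -> a <= b -> b <= T ->
  (forall s, a <= s <= b -> `|f s - c| <= B) ->
  `|(\int[mu]_(s in `[0, b]) f s) - (\int[mu]_(s in `[0, a]) f s) - c * (b - a)|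
    <= B * (b - a).
Proof.
move=> cf a0 ab bT fB.
have ifb := within_continuous_integrable bT cf.
rewrite Rintegral_itvB ?bnd_simp//.
have ifab : mu.-integrable `]a, b] (EFin \o f).
  apply: integrableS ifb => // s /=; rewrite !in_itv/= => /andP[as_ ->].
  by rewrite andbT (le_trans a0)// ltW.
have lab : lebesgue_measure (`]a, b]%classic : set R) = (b - a)%:E.
  rewrite lebesgue_measure_itv/= lte_fin; case: ltP => // ba.
  by rewrite (_ : a = b) ?subrr//; apply/le_anti; rewrite ab.
have icst (k : R) : mu.-integrable `]a, b] (EFin \o (fun=> k)).
  apply: integrableS (within_continuous_integrable (lexx b) (f := fun=> k) _) => //.
    move=> s /=; rewrite !in_itv/= => /andP[as_ ->].
    by rewrite andbT (le_trans a0)// ltW.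
  by apply: continuous_subspaceT; exact: cst_continuous.
have cstE (k : R) : k * (b - a) = \int[mu]_(s in `]a, b]) k.
  by rewrite Rintegral_cst//= lab.
rewrite !cstE -RintegralB//.
have iB : mu.-integrable `]a, b] (EFin \o (fun s => f s - c)).
  exact: (integrableB _ ifab (icst c)).
apply: (le_trans (le_normr_Rintegral _ iB)) => //.
apply: le_Rintegral => //.
  exact: (integrable_norm iB).
by move=> s /=; rewrite in_itv/= => /andP[/ltW as_ sb]; apply: fB; rewrite as_.
Qed.

Lemma grid_step_le_mesh (n i : nat) (t : nat -> R) : (i < n)%N ->
  `|t i.+1 - t i| <= mesh n t.
Proof.
move=> i_n; apply: (@le_bigmax_seq _ _ _ _ _ i.+1 xpredT (fun i => `|t i - t i.-1|)) => //.
by rewrite mem_index_iota.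
Qed.

Lemma mesh_ge0 (n : nat) (t : nat -> R) : 0 <= mesh n t.
Proof. exact: bigmax_ge_id. Qed.

Lemma riemann_sum_dist_le (T L : R) (f : R -> R) (n : nat) (t : nat -> R) k :
  is_partition T n t -> {within `[0, T], continuous f} -> 0 <= L ->
  (forall r s, 0 <= r <= T -> 0 <= s <= T -> `|f s - f r| <= L * `|s - r|) ->
  (k <= n)%N ->
  `|(\int[mu]_(s in `[0, t k]) f s) - \sum_(i < k) f (t i) * (t i.+1 - t i)|
    <= L * mesh n t * t k.
Proof.
move=> pt cf L0 fL; elim: k => [_|k IH kn].
  by have [-> _ _] := pt; rewrite big_ord0 set_itv1 Rintegral_set1 subrr normr0 mulr0.
have {}IH := IH (ltnW kn).
have tk0 := partition_ge0 pt (ltnW kn).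
have tT := partition_leT pt kn.
have tkS : t k <= t k.+1 by apply: (partition_le pt).
have step s : t k <= s <= t k.+1 -> `|f s - f (t k)| <= L * mesh n t.
  move=> /andP[ks sk]; apply: (@le_trans _ _ (L * `|s - t k|)).
    apply: fL; first by rewrite tk0 (le_trans tkS).
    by rewrite (le_trans tk0 ks) (le_trans sk).
  rewrite ler_wpM2l// (le_trans _ (grid_step_le_mesh t kn))//.
  by rewrite !ger0_norm ?subr_ge0// lerD2r.
have := Rintegral_increment_le cf tk0 tkS tT step.
rewrite big_ord_recr/=.
set I := \int[mu]_(s in `[0, t k.+1]) f s; set J := \int[mu]_(s in `[0, t k]) f s in IH *.
set E := \sum_(i < k) _ in IH *; move=> h.
rewrite (_ : I - _ = (I - J - f (t k) * (t k.+1 - t k)) + (J - E)); last by ring.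
apply: (le_trans (ler_normD _ _)).
rewrite (_ : L * mesh n t * t k.+1 =
  L * mesh n t * (t k.+1 - t k) + L * mesh n t * t k); last by ring.
exact: lerD.
Qed.

End riemann_sums.

(** * The test statistic on the grid *)

Section statistic.
Context {R : realType} {d : measure_display} {Omega : measurableType d}.
Implicit Types (T eps : R) (n k : nat) (t : nat -> R) (X : R -> Omega -> R).

Definition residual_sum (S0 : R -> R) t X k (w : Omega) : R :=
  \sum_(i < k) (X (t i.+1) w - X (t i) w - S0 (X (t i) w) * (t i.+1 - t i)).

Lemma grid_index T n t u : is_partition T n t -> 0 <= u <= T ->
  exists2 k, (k <= n)%N & t k <= u /\ forall j, (k < j <= n)%N -> u < t j.
Proof.
move=> pt /andP[u0 uT]; have [t0 tn _] := pt.
have ex0 : exists i, (i <= n)%N && (t i <= u) by exists 0%N; rewrite t0 u0.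
have ub i : (i <= n)%N && (t i <= u) -> (i <= n)%N by case/andP.
have [k /andP[kn tk] kmax] := ex_maxnP ex0 ub.
exists k => //; split => // j /andP[kj jn]; rewrite ltNge; apply/negP => tj.
by have := kmax j; rewrite jn tj => /(_ isT); rewrite leqNgt kj.
Qed.

Lemma U_statE S0 eps T n t X u k w : is_partition T n t -> 0 <= u ->
  (k <= n)%N -> t k <= u -> (forall j, (k < j <= n)%N -> u < t j) ->
  U_stat S0 eps n t X u w = eps^-1 * residual_sum S0 t X k w.
Proof.
move=> pt u0 kn tku ut; rewrite /U_stat; congr (_ * _).
rewrite big_add1/= (big_cat_nat (n := k))//= [X in _ + X]big1_seq ?addr0; last first.
  move=> i /andP[_]; rewrite mem_index_iota => /andP[ki i_n].
  rewrite indicE memNset ?mul0r//= in_itv/= => /andP[_].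
  by rewrite leNgt ut// ltnS ki.
rewrite big_mkord; apply: eq_bigr => i _.
have i_n : (i < n)%N by apply: leq_trans (ltn_ord i) _.
have ti : 0 <= t i.+1 - t i by rewrite subr_ge0 (partition_le pt).
rewrite indicE mem_set ?mul1r ?ger0_norm//= in_itv/= (partition_ge0 pt)//=.
by rewrite (le_trans _ tku)// (partition_le pt).
Qed.

Lemma U_stat_grid S0 eps T n t X k w : is_partition T n t -> (k <= n)%N ->
  U_stat S0 eps n t X (t k) w = eps^-1 * residual_sum S0 t X k w.
Proof.
move=> pt kn; apply: (U_statE _ _ _ _ pt) => //; first exact: (partition_ge0 pt).
move=> j /andP[kj jn]; have [_ _ tS] := pt.
by rewrite (lt_le_trans (tS k (leq_trans kj jn)))// (partition_le pt).
Qed.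

(** The path of the statistic is constant between two observation times, so its
    supremum is a maximum over the grid, and in particular measurable. The
    neutral element [0] is harmless as the terms are nonnegative. *)
Lemma sup_U_statE S0 eps T n t X w : is_partition T n t -> 0 < T ->
  sup_U_stat T S0 eps n t X w =
  \big[Num.max/0]_(k < n.+1) `|eps^-1 * residual_sum S0 t X k w|.
Proof.
move=> pt T0; rewrite /sup_U_stat; set A := [set _ | _ in _].
set M := \big[Num.max/0]_(k < _) _.
have AM : ubound A M.
  move=> _ [u /= u0T <-]; rewrite in_itv/= in u0T; have /andP[u0 _] := u0T.
  have [k kn [tku ut]] := grid_index pt u0T.
  rewrite (U_statE S0 eps X w pt u0 kn tku ut).
  exact: (le_bigmax_cond _ (fun k : 'I_n.+1 => `|eps^-1 * residual_sum S0 t X k w|)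
    (j := Ordinal (kn : (k < n.+1)%N))).
have Ak k : (k <= n)%N -> A `|eps^-1 * residual_sum S0 t X k w|.
  move=> kn; exists (t k); last by rewrite (U_stat_grid _ _ _ _ pt).
  by rewrite /= in_itv/= (partition_ge0 pt)// (partition_leT pt).
apply/le_anti/andP; split.
  by apply: ge_sup => //; exists (`|eps^-1 * residual_sum S0 t X 0 w|); exact: Ak.
have hasA : has_ubound A by exists M.
apply: bigmax_le => [|k _].
  by apply: le_trans (ub_le_sup hasA (Ak 0%N _)).
by apply: ub_le_sup => //; apply: Ak; rewrite -ltnS.
Qed.

End statistic.

(** * Estimates for the residual sums *)

Section residual_estimates.
Context {R : realType}.
Notation mu := (@lebesgue_measure R).

Lemma measurable_bigmax (d : measure_display) (Omega : measurableType d) N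
    (f : nat -> Omega -> R) :
  (forall k, (k < N)%N -> measurable_fun setT (f k)) ->
  measurable_fun setT (fun w => \big[Num.max/0]_(k < N) f k w).
Proof.
elim: N f => [|N IH] f mf.
  by under eq_fun do rewrite big_ord0; exact: measurable_cst.
under eq_fun do rewrite big_ord_recl/=.
apply: measurable_maxr; first exact: mf.
by apply: (IH (fun k => f k.+1)) => k kN; exact: mf.
Qed.

Lemma measurable_inv : measurable_fun setT (@GRing.inv R).
Proof.
rewrite -(setUv [set (0:R)]); apply/measurable_funU => //.
  exact: measurableC.
split; first exact: measurable_fun_set1.
apply: open_continuous_measurable_fun; first exact/closed_openC/closed_eq.
by move=> x; rewrite inE => /= /eqP x0; exact: inv_continuous.
Qed.

Lemma markov_ge0 (d : measure_display) (Omega : measurableType d)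
    (P : probability Omega R) (f : Omega -> \bar R) (a b : R) :
  measurable_fun setT f -> (forall w, 0 <= f w)%E -> 0 < a ->
  (\int[P]_w f w <= b%:E)%E -> (P [set w | a%:E <= f w]%E <= (b / a)%:E)%E.
Proof.
move=> mf f0 a0 fb.
have := @le_integral_abse _ _ _ P setT measurableT f a mf a0.
rewrite setTI (_ : [set w | _] = [set w | a%:E <= f w]%E); last first.
  by apply/seteqP; split => w /=; rewrite gee0_abs.
under [X in (_ <= X)%E]eq_integral do rewrite gee0_abs//.
move=> /le_trans/(_ fb); rewrite -lee_pdivlMl// => /le_trans; apply.
by rewrite -EFinM mulrC.
Qed.

(** Both expressions telescope up to the terms in [S0], which is Lipschitz. *)
Lemma residual_sum_dist_le (d : measure_display) (Omega : measurableType d)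
    (C0 T : R) (S0 x : R -> R) (X : R -> Omega -> R) (n k : nat) (t : nat -> R) w :
  (forall u v, `|S0 u - S0 v| <= C0 * `|u - v|) ->
  is_partition T n t -> (k <= n)%N ->
  `|residual_sum S0 t X k w -
    (x (t k) - x 0 - \sum_(i < k) S0 (x (t i)) * (t i.+1 - t i))| <=
  `|X (t k) w - x (t k)| + `|X 0 w - x 0| +
    C0 * \sum_(i < k) `|X (t i) w - x (t i)| * (t i.+1 - t i).
Proof.
move=> S0C pt kn; have [t0 _ _] := pt.
have -> : residual_sum S0 t X k w = X (t k) w - X 0 w -
    \sum_(i < k) S0 (X (t i) w) * (t i.+1 - t i).
  rewrite /residual_sum sumrB; congr (_ - _).
  by rewrite -(big_mkord xpredT (fun i => X (t i.+1) w - X (t i) w)) telescope_sumr// t0.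
set A := \sum_(i < k) S0 (X _ _) * _; set B := \sum_(i < k) S0 (x _) * _.
rewrite (_ : _ - _ = (X (t k) w - x (t k)) - (X 0 w - x 0) - (A - B)); last by ring.
apply: (le_trans (ler_normB _ _)); apply: lerD; first exact: ler_normB.
rewrite /A /B -sumrB mulr_sumr; apply: (le_trans (ler_norm_sum _ _ _)).
apply: ler_sum => i _; rewrite -mulrBl normrM mulrA.
have ti : 0 <= t i.+1 - t i.
  by rewrite subr_ge0 (partition_le pt)// (leq_trans _ kn).
by rewrite [X in _ * X]ger0_norm// ler_wpM2r.
Qed.

(** Along the limit path the increments sum up to the integral of [S (xS s)]
    over [[0, t k]], so the residual is the integral of [S - S0], up to the error
    of a Riemann sum of [S0 (xS s)] and the integral over [[t k, u]]. Both are of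
    the order of the mesh because [xS] is Lipschitz. *)
Lemma drift_sum_dist_le (T C C0 : R) (S S0 xS : R -> R) (x0 : R) : 0 < T ->
  (forall u v, `|S u - S v| <= C * `|u - v|) ->
  (forall u v, `|S0 u - S0 v| <= C0 * `|u - v|) -> 0 <= C0 ->
  ode_solution T x0 S xS ->
  exists2 L, 0 <= L & forall n t u k, is_partition T n t -> 0 <= u <= T ->
    (k <= n)%N -> t k <= u -> (forall j, (k < j <= n)%N -> u < t j) ->
  `|xS (t k) - xS 0 - (\sum_(i < k) S0 (xS (t i)) * (t i.+1 - t i)) -
    \int[mu]_(s in `[0, u]) (S (xS s) - S0 (xS s))| <= L * mesh n t.
Proof.
move=> T0 SC S0C C00 xode.
have cS := lipschitz_continuous SC; have cS0 := lipschitz_continuous S0C.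
have [_ cx _] := xode.
have xE s : 0 <= s <= T -> xS s = x0 + \int[mu]_(r in `[0, s]) S (xS r).
  exact: ode_solution_integral.
have cSx : {within `[0, T], continuous (S \o xS)} by exact: within_continuous_comp.
have cS0x : {within `[0, T], continuous (S0 \o xS)} by exact: within_continuous_comp.
have cd : {within `[0, T], continuous (fun s => S (xS s) - S0 (xS s))}.
  exact: within_continuousB cSx cS0x.
have bnd (f : R -> R) : {within `[0, T], continuous f} ->
    exists2 B, 0 <= B & forall s, 0 <= s <= T -> `|f s| <= B.
  move=> cf; have [c _ cmax] := @EVT_max R (fun s => `|f s|) 0 T (ltW T0)
    (within_continuous_comp cf (@norm_continuous _ _)).
  by exists (`|f c|) => // s s0T; apply: cmax; rewrite in_itv.
have [B1 B10 SB1] := bnd _ cSx.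
have [B2 B20 SB2] := bnd _ cd.
have xL r s : 0 <= r <= T -> 0 <= s <= T -> `|xS s - xS r| <= B1 * `|s - r|.
  wlog rs : r s / r <= s.
    move=> wl r0T s0T; have [|/ltW sr] := leP r s; first by move=> ?; exact: wl.
    by rewrite distrC (distrC s); exact: wl.
  move=> r0T s0T; have /andP[r0 rT] := r0T; have /andP[s0 sT] := s0T.
  have hB u : r <= u <= s -> `|(S \o xS) u - 0| <= B1.
    by move=> /andP[ru us]; rewrite subr0; apply: SB1; rewrite (le_trans r0) ?(le_trans us).
  have := Rintegral_increment_le cSx r0 rs sT hB.
  rewrite mul0r subr0 (xE s s0T) (xE r r0T) [X in _ -> _ <= _ * X]ger0_norm ?subr_ge0//.
  by rewrite opprD addrACA subrr add0r.
have S0L r s : 0 <= r <= T -> 0 <= s <= T ->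
    `|(S0 \o xS) s - (S0 \o xS) r| <= C0 * B1 * `|s - r|.
  move=> r0T s0T; apply: (le_trans (S0C _ _)); rewrite -mulrA ler_wpM2l//.
  exact: xL.
exists (C0 * B1 * T + B2); first by rewrite addr_ge0// mulr_ge0 ?(ltW T0)// mulr_ge0.
move=> n t u k pt /andP[u0 uT] kn tku ut.
have tk0 := partition_ge0 pt kn.
have tkT := partition_leT pt kn.
have mesh0 := mesh_ge0 n t.
have umesh : u - t k <= mesh n t.
  have [kn'|] := ltnP k n.
    rewrite (le_trans _ (grid_step_le_mesh t kn'))// (le_trans _ (ler_norm _))// lerD2r ltW//.
    by apply: ut; rewrite ltnSn.
  move=> nk; have kE : k = n by apply/eqP; rewrite eqn_leq kn.
  have [_ tn _] := pt; rewrite kE tn.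
  by apply: le_trans mesh0; rewrite subr_le0.
have hB s : t k <= s <= u -> `|(S (xS s) - S0 (xS s)) - 0| <= B2.
  by move=> /andP[ks su]; rewrite subr0; apply: SB2; rewrite (le_trans tk0) ?(le_trans su).
have inc := Rintegral_increment_le cd tk0 tku uT hB.
have mC : 0 <= C0 * B1 by rewrite mulr_ge0.
have rie := riemann_sum_dist_le pt cS0x mC S0L kn.
have iS := within_continuous_integrable tkT cSx.
have iS0 := within_continuous_integrable tkT cS0x.
have phiE : \int[mu]_(s in `[0, t k]) (S (xS s) - S0 (xS s)) =
    xS (t k) - xS 0 - \int[mu]_(s in `[0, t k]) S0 (xS s).
  rewrite RintegralB//; congr (_ - _).
  rewrite (xE (t k)) ?tk0// (xE 0) ?lexx ?ltW//.
  by rewrite set_itv1 Rintegral_set1 addr0 addrC addKr.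
rewrite mul0r subr0 phiE in inc.
set I := \int[mu]_(s in `[0, u]) _ in inc *.
set J := \int[mu]_(s in `[0, t k]) _ in inc rie *.
set E := \sum_(i < k) _ in rie *.
rewrite (_ : _ - _ = (J - E) - (I - (xS (t k) - xS 0 - J))); last by ring.
apply: (le_trans (ler_normB _ _)); rewrite mulrDl; apply: lerD.
  apply: (le_trans rie); rewrite mulrAC ler_wpM2r// ler_wpM2l//.
by apply: (le_trans inc); rewrite ler_wpM2l.
Qed.

(** Here [r] is a residual sum, [D] its value along the limit path and [phi] the
    integrated difference of the drifts. Two errors of [`|phi| / 4] leave
    [`|r| >= `|phi| / 2]; the denominator [sh] is at most [3 * Sig / 2]. *)
Lemma standardized_signal_gt (eps Sig M r D phi s sh : R) :
  0 < eps -> 0 < Sig -> eps * (3 * Sig * (`|M| + 1)) < `|phi| ->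
  `|r - D| <= `|phi| / 4 -> `|D - phi| <= `|phi| / 4 ->
  `|eps^-1 * r| <= s -> `|sh - Sig| < Sig / 2 -> M < `|s / sh|.
Proof.
move=> eps0 Sig0 epsM rD Dphi rs.
rewrite ltr_norml => /andP[sh_gt sh_lt].
have r_ge : `|phi| / 2 <= `|r|.
  have : `|phi| <= `|r| + (`|r - D| + `|D - phi|).
    have phiE : phi = r - ((r - D) + (D - phi)) by ring.
    rewrite {1}phiE; apply: (le_trans (ler_normB _ _)).
    by rewrite lerD2l; exact: ler_normD.
  lra.
have s_ge : `|phi| <= s * (2 * eps).
  move: rs; rewrite normrM (ger0_norm (x := eps^-1)) ?invr_ge0 ?(ltW eps0)//.
  by rewrite mulrC ler_pdivrMr// => rs; lra.
have sh0 : 0 < sh by lra.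
have sh3 : sh <= 3 * Sig / 2 by lra.
apply: (le_lt_trans (ler_norm M)).
rewrite normrM normfV (gtr0_norm sh0) ltr_pdivlMr//.
apply: lt_le_trans (ler_norm _).
have M_sh : `|M| * sh <= `|M| * (3 * Sig / 2) by rewrite ler_wpM2l.
apply: (le_lt_trans M_sh); rewrite -(@ltr_pM2r _ (2 * eps)) ?mulr_gt0//.
apply: lt_le_trans s_ge; apply: le_lt_trans epsM.
by have := mulr_gt0 eps0 Sig0; lra.
Qed.

End residual_estimates.

(** * The residual sums under the alternative *)

Section residual_noise.
Context {R : realType} {d : measure_display} {Omega : measurableType d}.
Variable P : probability Omega R.
Notation mu := (@lebesgue_measure R).

(** Every error is at most a multiple of [`|eps * Z|], and
    [`|z| <= 1 + z ^+ 2] turns the sum of all of them into [eps * V] with [V] affine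
    in the squares [Z s w ^+ 2]. Uniformly in the grid the expectation of [V] is
    at most [b], so Markov's inequality bounds [V] by [8 * b + 8] off a set of
    probability at most [8^-1]. *)
Lemma residual_sum_drift_prob (T C C0 kappa x0 : R) (S S0 xS : R -> R) : 0 < T ->
  0 <= C -> 0 <= C0 -> 0 <= kappa ->
  (forall u v, `|S u - S v| <= C * `|u - v|) ->
  (forall u v, `|S0 u - S0 v| <= C0 * `|u - v|) ->
  ode_solution T x0 S xS ->
  exists2 v, 0 < v & forall n t k eps (X Z : R -> Omega -> R),
    is_partition T n t -> (k <= n)%N -> 0 < eps ->
    continuous_paths T X -> continuous_paths T Z ->
    (forall s, 0 <= s <= T -> measurable_fun setT (Z s)) ->
    (forall s, 0 <= s <= T -> (\int[P]_w (Z s w ^+ 2)%:E <= kappa%:E)%E) ->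
    {ae P, forall w, forall s, s \in `[0, T] ->
       X s w = x0 + (\int[mu]_(r in `[0, s]) S (X r w)) + eps * Z s w} ->
    exists A, [/\ measurable A, (P A <= (8^-1)%:E)%E &
      forall w, ~ A w ->
      `|residual_sum S0 t X k w - (xS (t k) - xS 0 -
          \sum_(i < k) S0 (xS (t i)) * (t i.+1 - t i))| <= eps * v].
Proof.
move=> T0 C_ge0 C00 kappa0 SC S0C xode.
have cS := lipschitz_continuous SC.
have [_ cx _] := xode.
have xE s : 0 <= s <= T -> xS s = x0 + \int[mu]_(r in `[0, s]) S (xS r).
  exact: ode_solution_integral.
have T_ge0 := ltW T0.
pose K := C * expR (C * T).
have K0 : 0 <= K by rewrite mulr_ge0// expR_ge0.
pose a1 := (2 + C0 * T) * K.
have C0T : 0 <= C0 * T by rewrite mulr_ge0.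
have a10 : 0 <= a1 by rewrite mulr_ge0// addr_ge0.
pose a0 := a1 * T + 2 + C0 * T.
have a00 : 0 <= a0 by rewrite !addr_ge0// mulr_ge0.
pose b := a0 + a1 * (kappa * T) + (2 * kappa + C0 * kappa * T).
have b0 : 0 <= b.
  have kT0 := mulr_ge0 kappa0 T_ge0; have a1k := mulr_ge0 a10 kT0.
  have ck := mulr_ge0 (mulr_ge0 C00 kappa0) T_ge0; rewrite /b; lra.
exists (8 * b + 8); first by rewrite ltr_wpDl// mulr_ge0.
move=> n t k eps X Z pt kn eps0 cX cZ mZ Zkappa XE.
have lT := lebesgue_measure_itv0T T0.
have tk : 0 <= t k <= T by rewrite (partition_ge0 pt) ?(partition_leT pt).
have ti i : (i < k)%N -> 0 <= t i <= T.
  by move=> ik; rewrite (partition_ge0 pt) ?(partition_leT pt)// (leq_trans (ltnW ik)).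
have z0 : 0 <= (0 : R) <= T by rewrite lexx.
have di i : (i < k)%N -> 0 <= t i.+1 - t i.
  by move=> ik; rewrite subr_ge0 (partition_le pt)// (leq_trans ik).
have sumd : \sum_(i < k) (t i.+1 - t i) = t k.
  have [t0 _ _] := pt.
  by rewrite -(big_mkord xpredT (fun i => t i.+1 - t i)) telescope_sumr// t0 subr0.
pose J w := (\int[mu]_(s in `[0%R, T]) (Z s w ^+ 2)%:E)%E.
pose Q w := Z (t k) w ^+ 2 + Z 0 w ^+ 2 +
  C0 * \sum_(i < k) Z (t i) w ^+ 2 * (t i.+1 - t i).
pose V w := (a0%:E + (a1%:E * J w + (Q w)%:E))%E.
have jmZ := measurable_continuous_paths mZ cZ.
have mZ2 s : 0 <= s <= T -> measurable_fun setT (fun w => Z s w ^+ 2).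
  by move=> s0T; apply: measurable_funX; exact: mZ.
have jmZ2 : measurable_fun (`[0, T] `*` [set: Omega]) (fun p => (Z p.1 p.2 ^+ 2)%:E).
  by apply/measurable_EFinP; exact: measurable_funX.
have Z20 (p : R * Omega) : (0 <= (Z p.1 p.2 ^+ 2)%:E)%E by rewrite lee_fin sqr_ge0.
have mJ : measurable_fun setT J.
  exact: (@measurable_integral_section _ _ _ `[0, T]%classic
    (fun p => (Z p.1 p.2 ^+ 2)%:E)).
have J0 w : (0 <= J w)%E by apply: integral_ge0 => s _; rewrite lee_fin sqr_ge0.
have EJ : (\int[P]_w J w <= (kappa * T)%:E)%E.
  rewrite (@tonelli_section _ _ _ P `[0, T]%classic
    (fun p => (Z p.1 p.2 ^+ 2)%:E))//.
  apply: (@le_trans _ _ (\int[mu]_(s in `[0%R, T]) kappa%:E)%E).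
    apply: ge0_le_integral => //.
    - by move=> s _; apply: integral_ge0 => w _.
    - exact: (@measurable_integral_time_section _ _ _ P `[0, T]%classic
        (fun p => (Z p.1 p.2 ^+ 2)%:E)).
  by rewrite integral_cst//= lT -EFinM.
pose Q3 (i : 'I_k) w := Z (t i) w ^+ 2 * (t i.+1 - t i).
have mQ3 i : measurable_fun setT (Q3 i).
  by apply: measurable_funM => //; exact/mZ2/ti.
have Q30 i w : 0 <= Q3 i w by rewrite mulr_ge0 ?sqr_ge0// di.
have mQ3sum : measurable_fun setT (fun w => \sum_(i < k) Q3 i w).
  exact: measurable_sum.
have mQ : measurable_fun setT Q.
  apply: measurable_funD; first by apply: measurable_funD; exact: mZ2.
  exact: measurable_funM.
have Q0 w : 0 <= Q w.
  rewrite addr_ge0 ?addr_ge0 ?sqr_ge0// mulr_ge0// sumr_ge0// => i _.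
  exact: Q30.
have EQ3 : (\int[P]_w (\sum_(i < k) Q3 i w)%:E <= (kappa * T)%:E)%E.
  under eq_integral do rewrite -sumEFin.
  rewrite ge0_integral_sum//; last 2 first.
  - by move=> i; exact/measurable_EFinP.
  - by move=> i w _; rewrite lee_fin.
  apply: (@le_trans _ _ (\sum_(i < k) (kappa * (t i.+1 - t i))%:E)%E).
    apply: lee_sum => i _; rewrite /Q3.
    under eq_integral do rewrite EFinM.
    rewrite ge0_integralZr//; last 3 first.
    - exact/measurable_EFinP/mZ2/ti.
    - by move=> w _; rewrite lee_fin sqr_ge0.
    - by rewrite lee_fin di.
    by rewrite EFinM lee_wpmul2r ?lee_fin ?di// Zkappa// ti.
  by rewrite sumEFin -mulr_sumr sumd lee_fin ler_wpM2l//; case/andP: tk.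
have EQ : (\int[P]_w (Q w)%:E <= (2 * kappa + C0 * kappa * T)%:E)%E.
  under eq_integral do rewrite EFinD EFinD.
  rewrite ge0_integralD//; last 4 first.
  - by move=> w _; rewrite -EFinD lee_fin addr_ge0// sqr_ge0.
  - by apply: emeasurable_funD; exact/measurable_EFinP/mZ2.
  - by move=> w _; rewrite lee_fin mulr_ge0// sumr_ge0// => i _; exact: Q30.
  - by apply/measurable_EFinP; exact: measurable_funM.
  rewrite ge0_integralD//; last 4 first.
  - by move=> w _; rewrite lee_fin sqr_ge0.
  - exact/measurable_EFinP/mZ2.
  - by move=> w _; rewrite lee_fin sqr_ge0.
  - exact/measurable_EFinP/mZ2.
  under [X in (_ + X)%E]eq_integral do rewrite EFinM.
  rewrite ge0_integralZl//; last 2 first.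
  - exact/measurable_EFinP.
  - by move=> w _; rewrite lee_fin sumr_ge0// => i _; exact: Q30.
  rewrite EFinD (_ : 2 * kappa = kappa + kappa); last by ring.
  rewrite EFinD -mulrA EFinM; apply: leeD; first by apply: leeD; exact: Zkappa.
  by rewrite lee_wpmul2l.
have mV : measurable_fun setT V.
  apply: emeasurable_funD => //; apply: emeasurable_funD; last exact/measurable_EFinP.
  exact: measurable_funeM.
have a1J0 w : (0 <= a1%:E * J w)%E by rewrite mule_ge0.
have V0 w : (0 <= V w)%E by rewrite adde_ge0// adde_ge0// lee_fin.
have EV : (\int[P]_w V w <= b%:E)%E.
  rewrite /V ge0_integralD//; last 2 first.
  - by move=> w _; rewrite adde_ge0// lee_fin.
  - by apply: emeasurable_funD; [exact: measurable_funeM|exact/measurable_EFinP].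
  rewrite ge0_integralD//; last 3 first.
  - exact: measurable_funeM.
  - by move=> w _; rewrite lee_fin.
  - exact/measurable_EFinP.
  rewrite integral_cst//= probability_setT mule1 ge0_integralZl//.
  rewrite /b -addrA [leRHS]EFinD leeD2l// [leRHS]EFinD leeD//.
  by rewrite [leRHS]EFinM lee_wpmul2l.
have b8 : 0 < 8 * b + 8 by rewrite ltr_wpDl// mulr_ge0.
have PV := markov_ge0 mV V0 b8 EV.
set A1 := [set w | _] in PV.
have mA1 : measurable A1 by rewrite -[A1]setTI; exact: emeasurable_fun_c_infty.
have [N [mN PN0 XEN]] := XE.
(* [N] is the null set on which the stochastic equation may fail. *)
exists (A1 `|` N); split.
- exact: measurableU.
- apply: (le_trans (measureU2 _ mA1 mN)); rewrite -[leRHS]adde0.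
  apply: leeD; last by rewrite [leLHS]PN0.
  by apply: (le_trans PV); rewrite lee_fin ler_pdivrMr//; lra.
- move=> w /not_orP[A1w Nw].
  have XEw : forall s, s \in `[0, T] ->
      X s w = x0 + (\int[mu]_(r in `[0, s]) S (X r w)) + eps * Z s w.
    by apply: contrapT => h; apply: Nw; exact: XEN.
  have cz : {within `[0, T], continuous (fun s => Z s w)} := cZ w.
  have sq_within : mu.-integrable `[0, T] (EFin \o (fun s => Z s w ^+ 2)).
    apply: within_continuous_integrable (lexx T) _.
    by apply: (@within_continuous_comp _ _ (Z^~ w) (fun u => u ^+ 2)) => //; exact: exprn_continuous.
  pose Jr := \int[mu]_(s in `[0, T]) Z s w ^+ 2.
  have JE : J w = Jr%:E.
    by rewrite /Jr /Rintegral fineK//; apply: integrable_fin_num.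
  have Vlt : a0 + a1 * Jr + Q w <= 8 * b + 8.
    move/negP : A1w; rewrite -ltNge /V JE -EFinM -!EFinD lte_fin => /ltW.
    by rewrite addrA.
  have cez : {within `[0, T], continuous (fun s => eps * Z s w)}.
    apply: (@within_continuous_comp _ _ (Z^~ w) (fun u => eps * u)) => //.
    exact: mulrl_continuous.
  have ceza : {within `[0, T], continuous (fun s => `|eps * Z s w|)}.
    by apply: (within_continuous_comp cez); exact: norm_continuous.
  have icst := integrable_cst0T T.
  have i1 : mu.-integrable `[0, T] (EFin \o (fun s => 1 + Z s w ^+ 2)).
    exact: (integrableD _ (icst 1) sq_within).
  have abs_le (z : R) : `|eps * z| <= eps * (1 + z ^+ 2).
    rewrite normrM (ger0_norm (ltW eps0)) ler_wpM2l ?(ltW eps0)//.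
    have := sqr_ge0 (`|z| - 1); rewrite -[z ^+ 2]real_normK ?num_real//.
    by have := normr_ge0 z; nra.
  have Iz : \int[mu]_(s in `[0, T]) `|eps * Z s w| <= eps * (T + Jr).
    apply: (@le_trans _ _ (\int[mu]_(s in `[0, T]) (eps * (1 + Z s w ^+ 2)))).
      apply: le_Rintegral => //.
        exact: within_continuous_integrable (lexx T) ceza.
      exact: (integrableZl _ eps i1).
    by rewrite RintegralZl// RintegralD// Rintegral_cst//= lT mul1r.
  have dist s : 0 <= s <= T ->
      `|X s w - xS s| <= eps * (K * (T + Jr) + 1 + Z s w ^+ 2).
    move=> s0T.
    apply: (le_trans (perturbed_ode_dist_le T0 C_ge0 SC cx (cX w) cez xE XEw s0T)).
    rewrite -/K -addrA mulrDr; apply: lerD; last exact: abs_le.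
    by rewrite mulrCA ler_wpM2l.
  apply: (le_trans (residual_sum_dist_le xS X w S0C pt kn)).
  set G := K * (T + Jr) in dist.
  have G0 : 0 <= G.
    rewrite mulr_ge0// addr_ge0// /Jr Rintegral_ge0// => s _; exact: sqr_ge0.
  have sum_le : \sum_(i < k) `|X (t i) w - xS (t i)| * (t i.+1 - t i) <=
      eps * ((G + 1) * T + \sum_(i < k) Z (t i) w ^+ 2 * (t i.+1 - t i)).
    apply: (@le_trans _ _ (\sum_(i < k) (eps * (G + 1) * (t i.+1 - t i) +
        eps * (Z (t i) w ^+ 2 * (t i.+1 - t i))))).
      apply: ler_sum => i _.
      apply: (@le_trans _ _ (eps * (G + 1 + Z (t i) w ^+ 2) * (t i.+1 - t i))).
        by rewrite ler_wpM2r ?di// dist// ti.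
      by rewrite le_eqVlt; apply/orP; left; apply/eqP; ring.
    rewrite big_split/= -!mulr_sumr sumd [leRHS]mulrDr lerD2r -mulrA ler_wpM2l ?(ltW eps0)//.
    by rewrite ler_wpM2l ?addr_ge0//; case/andP: tk.
  apply: (@le_trans _ _ (eps * (a0 + a1 * Jr + Q w))); last first.
    by rewrite ler_wpM2l ?(ltW eps0).
  have dk := dist _ tk; have d0 := dist _ z0.
  have cs := ler_wpM2l C00 sum_le.
  rewrite (_ : eps * _ = eps * (G + 1 + Z (t k) w ^+ 2) + eps * (G + 1 + Z 0 w ^+ 2) +
    C0 * (eps * ((G + 1) * T + \sum_(i < k) Z (t i) w ^+ 2 * (t i.+1 - t i)))).
    by apply: lerD => //; exact: lerD.
  by rewrite /Q /a0 /a1 /G; ring.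
Qed.

End residual_noise.

(** * Unboundedness of the test statistic *)

Unset Implicit Arguments.

Theorem theorem8 (R : realType) (d : measure_display) (Omega : measurableType d)
    (P : probability Omega R) (T x0 : R) (F : R -> set_system Omega)
    (W : R -> Omega -> R) (S0 sigma S xS : R -> R)
    (X : R -> R -> Omega -> R) (n : R -> nat) (t : R -> nat -> R)
    (Sigmahat : R -> Omega -> R) :
  0 < T ->
  is_filtration T F ->
  is_wiener P T F W ->
  conditions P T F W x0 S0 sigma ->
  alternative_class P T F W x0 S0 sigma S ->
  ode_solution T x0 S xS ->
  (forall eps : R, 0 < eps -> sde_solution P T F W x0 S sigma eps (X eps)) ->
  sampling_scheme T n t ->
  (forall eps : R, 0 < eps -> measurable_fun setT (Sigmahat eps)) ->
  cvg_in_probability P 0^'+ Sigmahat (fun=> Sigma_of T sigma xS) ->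
  ~ bounded_in_probability P 0^'+
      (fun eps w => sup_U_stat T S0 eps (n eps) (t eps) (X eps) w /
                    Sigmahat eps w).
Proof.
move=> T0 hF hW [[C0 C00 lip0] _ _] [[A1S A2S A3S] altS] xode hX [hpart hmesh] mSigma cvgSigma.
have [C C_gt0 lipS] := A1S.
have SC u v : `|S u - S v| <= C * `|u - v| by have [] := lipS u v.
have S0C u v : `|S0 u - S0 v| <= C0 * `|u - v| by have [] := lip0 u v.
have Sig0 : 0 < Sigma_of T sigma xS := A3S xS xode.
set Sig := Sigma_of T sigma xS in Sig0 cvgSigma.
have [u u0T phi0] := altS xS xode.
set phi := \int[_]_(s in _) _ in phi0.
have {}u0T : 0 <= u <= T by move: u0T; rewrite in_itv.
have rho0 : 0 < `|phi| by rewrite normr_gt0.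
set rho := `|phi| in rho0.
have [kappa kappa0 [eps0 eps0_gt0 noise]] :=
  sde_noise_second_moment_le hF hW T0 A1S A2S xode.
have [L L0 drift] := drift_sum_dist_le T0 SC S0C (ltW C00) xode.
have [v v0 resid] := residual_sum_drift_prob P T0 (ltW C_gt0) (ltW C00) kappa0 SC S0C xode.
(* Boundedness is refuted at the level [2^-1]: with probability at least
   [1 - 8^-1 - 8^-1] the statistic exceeds any given [M]. *)
move=> /(_ 2^-1)[]; first by rewrite invr_gt0.
move=> M hM.
have mesh_small : \forall eps \near (0:R)^'+, mesh (n eps) (t eps) <= eps ^+ 2.
  have /eqoP/(_ 1 ltr01) := hmesh.
  apply: filterS => eps /=; rewrite mul1r ger0_norm ?mesh_ge0// ger0_norm ?sqr_ge0//.
have Sig_close : \forall eps \near (0:R)^'+,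
    (P [set w | (Sig / 2 <= `|Sigmahat eps w - Sig|)%R] <= (8^-1)%:E)%E.
  by apply: cvg0_near_le; [rewrite invr_gt0|apply: cvgSigma; rewrite divr_gt0].
have c0 : 0 < 3 * Sig * (`|M| + 1) by rewrite !mulr_gt0// ltr_wpDl.
suff : \forall eps \near (0:R)^'+, False by move=> /filter_ex[].
near=> eps.
have eps_gt0 : 0 < eps by near: eps; exact: nbhs_right_gt.
have eps_lt1 : eps < 1 by near: eps; exact: nbhs_right_lt.
have eps_lt0 : eps < eps0 by near: eps; exact: nbhs_right_lt.
have epsL : L * eps ^+ 2 <= rho / 4.
  apply: (@le_trans _ _ ((L + 1) * eps)).
    by rewrite ler_pM ?sqr_ge0 ?lerDl// expr2 ler_piMr// ltW.
  rewrite mulrC -ler_pdivlMr ?ltr_wpDl// ltW//.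
  by near: eps; apply: nbhs_right_lt; rewrite !divr_gt0// ltr_wpDl.
have epsv : eps * v <= rho / 4.
  rewrite -ler_pdivlMr// ltW//.
  by near: eps; apply: nbhs_right_lt; rewrite !divr_gt0.
have epsM : eps * (3 * Sig * (`|M| + 1)) < rho.
  rewrite -ltr_pdivlMr//.
  by near: eps; apply: nbhs_right_lt; apply: divr_gt0.
have meshE : mesh (n eps) (t eps) <= eps ^+ 2 by near: eps.
have PSig : (P [set w | (Sig / 2 <= `|Sigmahat eps w - Sig|)%R] <= (8^-1)%:E)%E.
  by near: eps.
have PM : (P [set w | (M < `|sup_U_stat T S0 eps (n eps) (t eps) (X eps) w /
    Sigmahat eps w|)%R] <= (2^-1)%:E)%E by near: eps.
have Lmesh : L * mesh (n eps) (t eps) <= rho / 4.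
  by apply: le_trans epsL; rewrite ler_wpM2l.
have pt := hpart eps eps_gt0.
have [k kn [tku ut]] := grid_index pt u0T.
have [adX cX _ _] := hX eps eps_gt0.
have [Z [mZ cZ XE Zk]] := noise eps eps_gt0 eps_lt0 (X eps) (hX eps eps_gt0).
have [A [mA PA Aresid]] := resid _ _ _ _ _ _ pt kn eps_gt0 cX cZ mZ Zk XE.
have drk := drift _ _ _ _ pt u0T kn tku ut.
have mX s : 0 <= s <= T -> measurable_fun setT (X eps s).
  by move=> s0T; exact: (filtration_measurable_fun hF s0T (adX _ s0T)).
have cS0 := lipschitz_continuous S0C.
have msup : measurable_fun setT (sup_U_stat T S0 eps (n eps) (t eps) (X eps)).
  rewrite (_ : sup_U_stat _ _ _ _ _ _ = fun w =>
    \big[Num.max/0]_(k < (n eps).+1) `|eps^-1 * residual_sum S0 (t eps) (X eps) k w|); last first.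
    by apply/funext => w; exact: sup_U_statE.
  apply: (measurable_bigmax (f := fun k w => `|eps^-1 * residual_sum S0 (t eps) (X eps) k w|)).
  move=> j jn; apply: measurableT_comp => //; apply: measurable_funM => //.
  apply: measurable_sum => i.
  have ij : (i < n eps)%N by apply: leq_trans (ltn_ord i) _.
  have ti : 0 <= t eps i <= T by rewrite (partition_ge0 pt) ?(partition_leT pt)// ltnW.
  have tiS : 0 <= t eps i.+1 <= T by rewrite (partition_ge0 pt) ?(partition_leT pt).
  apply: measurable_funB; first by apply: measurable_funB; exact: mX.
  apply: measurable_funM => //; apply: (measurableT_comp _ (mX _ ti)).
  exact: continuous_measurable_fun.
set B := [set w | Sig / 2 <= _] in PSig.
set E := [set w | M < _] in PM.
have mB : measurable B.
  rewrite -[B]setTI; apply: measurable_fun_le => //.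
  apply: measurableT_comp => //; apply: measurable_funB => //.
  exact: mSigma.
have mE : measurable E.
  rewrite (_ : E = ~` [set w | `|sup_U_stat T S0 eps (n eps) (t eps) (X eps) w /
      Sigmahat eps w| <= M]); last first.
    by apply/seteqP; split=> w; rewrite /E/= ltNge => /negP.
  apply: measurableC; rewrite -[X in measurable X]setTI.
  apply: measurable_fun_le => //; apply: measurableT_comp => //.
  apply: measurable_funM => //; apply: (measurableT_comp measurable_inv).
  exact: mSigma.
have cover : setT `<=` E `|` (A `|` B).
  move=> w _; have [Aw|nAw] := pselect (A w); first by right; left.
  have [Bw|nBw] := pselect (B w); first by right; right.
  left; rewrite /E/=.
  have ek := Aresid w nAw.
  have Bw : `|Sigmahat eps w - Sig| < Sig / 2 by rewrite ltNge; apply/negP.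
  apply: (standardized_signal_gt eps_gt0 Sig0 epsM _ _ _ Bw).
  - exact: le_trans ek epsv.
  - exact: le_trans drk Lmesh.
  - rewrite (sup_U_statE S0 eps (X eps) w pt T0).
    exact: (le_bigmax_cond _ (fun k : 'I_(n eps).+1 =>
      `|eps^-1 * residual_sum S0 (t eps) (X eps) k w|) (j := Ordinal (kn : (k < (n eps).+1)%N))).
have : (1 <= P (E `|` (A `|` B)))%E.
  rewrite -(probability_setT P); apply: le_measure; rewrite ?inE//.
  by apply: measurableU => //; exact: measurableU.
move/le_trans => /(_ _ (measureU2 _ mE (measurableU _ _ mA mB))).
have PAB : (P (A `|` B) <= (8^-1)%:E + (8^-1)%:E)%E.
  by apply: (le_trans (measureU2 _ mA mB)); exact: leeD.
move/le_trans => /(_ _ (leeD PM PAB)).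
rewrite -!EFinD lee_fin; apply/negP; rewrite -ltNge; clear; lra.
Unshelve. all: by end_near. Qed.
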